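(* Let $0<a<b$ and $\theta=1/2$, and let $h^k$, $k\ge 0$, be the interface errors generated from an initial guess $h^0$ by the Dirichlet--Neumann waveform relaxation (DNWR) iteration for the one-dimensional heat equation (error equations) on $(-a,b)$, with Dirichlet subdomain $(-a,0)$ and Neumann subdomain $(0,b)$. Then for $t\in(0,\infty)$ the error satisfies, for $k=1,2,3,\ldots$, the linear estimate $$\|h^{2k}\|_{L^\infty(0,\infty)}\le\left(\frac{b-a}{2a}\right)^{2k}\|h^0\|_{L^\infty(0,\infty)},$$ and on any finite time interval $(0,T)$, $T>0$, it satisfies, for $k=1,2,3,\ldots$, the superlinear estimate $$\|h^{2k}\|_{L^\infty(0,T)}\le\left(\frac{\sqrt2}{1-e^{-\frac{(2k+1)a^2}{T}}}\right)^{2k}e^{-k^2a^2/T}\,\|h^0\|_{L^\infty(0,T)}.$$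
   Context: DNWR iteration (error equations, heat equation $\partial_t u=\partial_{xx}u$ on $(-a,b)$ with $a,b>0$, interface at $x=0$, zero source, zero initial data and zero outer boundary data). Given a bounded initial guess $h^0(t)$ on the interface and a relaxation parameter $\theta\in(0,1]$, for $k=1,2,\ldots$ solve first the Dirichlet problem $$\partial_t u_1^k-\partial_{xx}u_1^k=0 \text{ on } (-a,0),\quad u_1^k(x,0)=0,\quad u_1^k(-a,t)=0,\quad u_1^k(0,t)=h^{k-1}(t),$$ then the Neumann problem $$\partial_t u_2^k-\partial_{xx}u_2^k=0 \text{ on } (0,b),\quad u_2^k(x,0)=0,\quad \partial_x u_2^k(0,t)=\partial_x u_1^k(0,t),\quad u_2^k(b,t)=0,$$ and update $h^k(t)=\theta u_2^k(0,t)+(1-\theta)h^{k-1}(t)$. The iteration is understood through the Laplace transform in time, $\hat u(x,s)=\int_0^\infty e^{-st}u(x,t)\,dt$, $\operatorname{Re}(s)>0$: $(s-\partial_{xx})\hat u_1^k=0$ on $(-a,0)$, $\hat u_1^k(-a,s)=0$, $\hat u_1^k(0,s)=\hat h^{k-1}(s)$; $(s-\partial_{xx})\hat u_2^k=0$ on $(0,b)$, $\partial_x\hat u_2^k(0,s)=\partial_x\hat u_1^k(0,s)$, $\hat u_2^k(b,s)=0$; $\hat h^k(s)=\theta\hat u_2^k(0,s)+(1-\theta)\hat h^{k-1}(s)$; and $h^k$ is the inverse Laplace transform of $\hat h^k$. If $h^0$ is given only on $(0,T)$, it is extended by zero (the values of $h^k$ on $(0,T)$ depend only on $h^0$ on $(0,T)$).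 The exact error solution is zero, so $h^k$ is the error on the interface. *)

(* Defs.v *)
From mathcomp Require Import all_boot all_order all_algebra.
From mathcomp Require Import all_classical all_reals all_analysis.
From mathcomp Require Import complex.

Set Implicit Arguments.
Unset Strict Implicit.
Unset Printing Implicit Defensive.
Import Order.TTheory GRing.Theory Num.Theory.
Import numFieldNormedType.Exports.

Local Open Scope classical_set_scope.
Local Open Scope ring_scope.
Local Open Scope complex_scope.

(* Functions of time have type [R -> R]; only their values on t > 0 matter. *)

(* The norm of L^oo(D).  Extending [f] by 0 off [D] does not change the
   essential supremum of |f| as long as [D] has positive measure. *)
Definition Linfty_norm (R : realType) (D : set R) (f : R -> R) : \bar R :=
  'N[@lebesgue_measure R]_+oo[EFin \o patch (fun=> 0%R) D f]%E.

Definition laplace_transformable (R : realType) (f : R -> R) : Prop :=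
  measurable_fun (`]0, +oo[%classic : set R) f /\
  forall sigma : R, 0 < sigma ->
    (@lebesgue_measure R).-integrable `]0, +oo[
      (EFin \o (fun t => expR (- (sigma * t)) * f t)).

(* e^(-st) = e^(- Re s t) (cos (Im s t) - i sin (Im s t)) *)
Definition laplace (R : realType) (f : R -> R) (s : R[i]) : R[i] :=
  (\int[@lebesgue_measure R]_(t in `]0, +oo[)
     (expR (- (complex.Re s * t)) * cos (complex.Im s * t) * f t))
  -i*
  (\int[@lebesgue_measure R]_(t in `]0, +oo[)
     (expR (- (complex.Re s * t)) * sin (complex.Im s * t) * f t)).

(* R[i] carries no normed-module structure over R in the library, so the
   derivatives in the real variable x are taken componentwise. *)
Definition re_part (R : realType) (u : R -> R[i]) : R -> R :=
  fun x => complex.Re (u x).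
Definition im_part (R : realType) (u : R -> R[i]) : R -> R :=
  fun x => complex.Im (u x).

Definition dxx (R : realType) (u : R -> R[i]) (x : R) : R[i] :=
  ((re_part u)^`(2)%classic x) +i* ((im_part u)^`(2)%classic x).

Definition C2_oo_cont (R : realType) (l r : R) (f : R -> R) : Prop :=
  derivable_oo_LRcontinuous f l r /\
  {in `]l, r[, forall x, derivable (f^`()%classic : R -> R) x 1}.

(* (s - d_xx) u = 0 on (l, r), with [u] continuous up to the endpoints *)
Definition solves_transformed_heat (R : realType) (s : R[i]) (l r : R)
    (u : R -> R[i]) : Prop :=
  [/\ C2_oo_cont l r (re_part u), C2_oo_cont l r (im_part u) &
      {in `]l, r[, forall x, s * u x - dxx u x = 0}].

(* one-sided derivatives, for the Neumann condition at the interface, which is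
   an endpoint of both subdomains *)
Definition has_left_derivative (R : realType) (u : R -> R[i]) (x : R)
    (d : R[i]) : Prop :=
  (h^-1 * (re_part u (x + h) - re_part u x) @[h --> 0^'-] --> complex.Re d) /\
  (h^-1 * (im_part u (x + h) - im_part u x) @[h --> 0^'-] --> complex.Im d).

Definition has_right_derivative (R : realType) (u : R -> R[i]) (x : R)
    (d : R[i]) : Prop :=
  (h^-1 * (re_part u (x + h) - re_part u x) @[h --> 0^'+] --> complex.Re d) /\
  (h^-1 * (im_part u (x + h) - im_part u x) @[h --> 0^'+] --> complex.Im d).

(* One DNWR sweep at the frequency [s]: [g] and [g'] are the transforms of the
   old and new interface traces, [u1] and [u2] the transformed subdomain
   solutions. *)
Record dnwr_sweep (R : realType) (a b theta : R) (s : R[i])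
    (g : R[i]) (u1 u2 : R -> R[i]) (g' : R[i]) : Prop := {
  sweep_eq1 : solves_transformed_heat s (- a) 0 u1 ;
  sweep_outer1 : u1 (- a) = 0 ;
  sweep_dirichlet : u1 0 = g ;
  sweep_eq2 : solves_transformed_heat s 0 b u2 ;
  sweep_neumann : exists d : R[i],
    has_left_derivative u1 0 d /\ has_right_derivative u2 0 d ;
  sweep_outer2 : u2 b = 0 ;
  sweep_update : g' = theta%:C * u2 0 + (1 - theta)%:C * g
}.

(* [h k] is the interface error h^k; [u1 k x s] and [u2 k x s] (k >= 1) are the
   transformed subdomain errors.  The values of [u1] and [u2] at k = 0, or
   where Re s <= 0, are irrelevant.  That [h k.+1] is the inverse Laplace
   transform of the updated trace is expressed by the last component of the
   sweep, whose new trace is the Laplace transform of [h k.+1]. *)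
Record dnwr_iteration (R : realType) (a b theta : R) (h : nat -> R -> R)
    (u1 u2 : nat -> R -> R[i] -> R[i]) : Prop := {
  dnwr_initial_measurable : measurable_fun (`]0, +oo[%classic : set R) (h 0%N) ;
  dnwr_initial_bounded : (Linfty_norm `]0%R, +oo[%classic (h 0%N) < +oo)%E ;
  dnwr_transformable : forall k, laplace_transformable (h k.+1) ;
  dnwr_step : forall k (s : R[i]), 0 < complex.Re s ->
    dnwr_sweep a b theta s (laplace (h k) s)
      (u1 k.+1 ^~ s) (u2 k.+1 ^~ s) (laplace (h k.+1) s)
}.

(* Main.v *)
(* On the real axis s > 0 the transformed sweep is an ordinary differential
   equation with constant coefficients, so that the transform of h^n is
   (-1/2)^n G(s)^n times that of h^0, where, with r = sqrt s,
   G(s) = sinh((b-a) r) / (sinh(a r) cosh(b r)).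
   The function G is completely monotone: replacing r by an angle th with
   cosh th = exp(s / (2 N^2)), i.e. Brownian motion by a random walk, each ratio
   sinh(i th) / sinh(j th) and cosh(i th) / cosh(j th), i <= j, is a power series
   in 1 / cosh th with nonnegative coefficients (gambler's ruin), and so is the
   discretised G; then let N tend to infinity.  Hence G^n is a pointwise limit of
   nonnegative combinations of exp(- u s), u >= 0, which act on functions of time
   as delays; testing against polynomials in exp(-t) that are nonnegative on
   [0, 1] gives, for every sg > 0 and every nondecreasing bound M of |h^0|,
   |h^n(t)| <= (G(sg) / 2)^n exp(sg t) M(t).  The linear estimate follows with
   sg -> 0, as G(0+) = (b - a) / a.  The superlinear one follows with
   sg = (2 k a / T)^2 for n = 2 k, because
   G(s) <= 2 exp(-2 a r) / (1 - exp(-2 a r)); here M is the norm of h^0 on (0, T)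
   before time T, and its norm on the half-line afterwards. *)
Require Import Defs.
From HB Require Import structures.
From mathcomp Require Import all_boot all_order all_algebra.
From mathcomp Require Import all_classical all_reals all_analysis.
From mathcomp Require Import complex.
From mathcomp Require Import measurable_realfun ess_sup_inf.
From mathcomp Require Import ring lra zify.
Import Order.TTheory GRing.Theory Num.Theory.
Import numFieldNormedType.Exports.

Local Open Scope classical_set_scope.
Local Open Scope ring_scope.
Set Implicit Arguments.
Unset Strict Implicit.
Unset Printing Implicit Defensive.

(** * Hyperbolic functions: addition formulas, signs, monotonicity *)

Section Hyperbolic.
Context {R : realType}.
Implicit Types x y : R.

Definition ch x : R := (expR x + expR (- x)) / 2.
Definition sh x : R := (expR x - expR (- x)) / 2.

Lemma ch0 : ch 0 = 1.
Proof. by rewrite /ch oppr0 expR0; field. Qed.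

Lemma sh0 : sh 0 = 0.
Proof. by rewrite /sh oppr0 expR0; field. Qed.

Lemma chN x : ch (- x) = ch x.
Proof. by rewrite /ch opprK addrC. Qed.

Lemma chDB x y : ch x * ch y = (ch (x + y) + ch (x - y)) / 2.
Proof.
rewrite /ch opprD opprB !expRD !expRN.
by field; rewrite !gt_eqF ?expR_gt0.
Qed.

Lemma shD x y : sh (x + y) = ch x * sh y + ch y * sh x.
Proof.
rewrite /sh /ch opprD !expRD !expRN.
by field; rewrite !gt_eqF ?expR_gt0.
Qed.

Lemma shB x y : sh (x - y) = ch y * sh x - ch x * sh y.
Proof.
rewrite /sh /ch opprD opprK !expRD !expRN.
by field; rewrite !gt_eqF ?expR_gt0.
Qed.

Lemma ch_gt0 x : 0 < ch x.
Proof. by rewrite /ch divr_gt0 ?addr_gt0 ?expR_gt0. Qed.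

Lemma sh_gt0 x : 0 < x -> 0 < sh x.
Proof. by move=> x0; rewrite /sh divr_gt0// subr_gt0 ltr_expR; lra. Qed.

Lemma ch_mono x y : 0 <= x -> x < y -> ch x < ch y.
Proof.
move=> x0 xy; rewrite -subr_gt0.
(* Sum-to-product formula: both factors are hyperbolic sines of positive numbers. *)
have -> : ch y - ch x = sh ((y + x) / 2) * sh ((y - x) / 2) * 2.
  rewrite /ch /sh (_ : expR y = expR ((y + x) / 2) * expR ((y - x) / 2)); last first.
    by rewrite -expRD; congr expR; field.
  rewrite (_ : expR x = expR ((y + x) / 2) / expR ((y - x) / 2)); last first.
    by rewrite -expRB; congr expR; field.
  rewrite (_ : expR (- y) = (expR ((y + x) / 2) * expR ((y - x) / 2))^-1); last first.
    by rewrite -expRD -expRN; congr expR; field.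
  rewrite (_ : expR (- x) = (expR ((y + x) / 2) / expR ((y - x) / 2))^-1); last first.
    by rewrite -expRB -expRN; congr expR; field.
  by rewrite !expRN; field; rewrite !gt_eqF ?expR_gt0.
by rewrite mulr_gt0// mulr_gt0//; apply: sh_gt0; rewrite divr_gt0//; lra.
Qed.

Lemma ch_gt1 x : 0 < x -> 1 < ch x.
Proof. by move=> x0; rewrite -ch0 ch_mono. Qed.

Lemma sh_continuous : continuous sh.
Proof.
move=> x; apply: cvgM; last exact: cvg_cst.
apply: cvgB; first exact: continuous_expR.
apply: continuous_comp; last exact: continuous_expR.
exact: oppr_continuous.
Qed.

Lemma ch_continuous : continuous ch.
Proof.
move=> x; apply: cvgM; last exact: cvg_cst.
apply: cvgD; first exact: continuous_expR.
apply: continuous_comp; last exact: continuous_expR.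
exact: oppr_continuous.
Qed.

End Hyperbolic.

(** * Nonnegative combinations of decaying exponentials and their limits *)

Section ExpSums.
Context {R : realType}.
Implicit Types (g h : R -> R) (c : seq (R * R)) (S : seq R).

(** A pair is a weight and a delay: multiplying a Laplace transform by [exp (- u l)] delays the
    function of time by [u]. *)
Definition exp_sum c (l : R) : R := \sum_(p <- c) p.1 * expR (- (p.2 * l)).

Definition nneg_pairs c := all (fun p => (0 <= p.1) && (0 <= p.2)) c.

(* By Bernstein's theorem these are the completely monotone functions. *)
Definition exp_sum_limit g := forall S (e : R), 0 < e ->
  (forall s, s \in S -> 0 < s) ->
  exists2 c, nneg_pairs c & forall s, s \in S -> `|g s - exp_sum c s| < e.

Lemma exp_sum_limit_exact g c : nneg_pairs c ->
  (forall s, 0 < s -> g s = exp_sum c s) -> exp_sum_limit g.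
Proof.
move=> c0 gc S e e0 S0; exists c => // s /S0 s0.
by rewrite gc// subrr normr0.
Qed.

Lemma exp_sum_limit_expR (u : R) : 0 <= u ->
  exp_sum_limit (fun l => expR (- (u * l))).
Proof.
move=> u0; apply: (@exp_sum_limit_exact _ [:: (1, u)]).
  by rewrite /nneg_pairs /= u0 ler01.
by move=> s _; rewrite /exp_sum big_seq1 mul1r.
Qed.

Lemma exp_sum_limit_cst (k : R) : 0 <= k -> exp_sum_limit (fun=> k).
Proof.
move=> k0; apply: (@exp_sum_limit_exact _ [:: (k, 0)]).
  by rewrite /nneg_pairs /= k0 lexx.
by move=> s _; rewrite /exp_sum big_seq1 mul0r oppr0 expR0 mulr1.
Qed.

Lemma exp_sum_limitD g h : exp_sum_limit g -> exp_sum_limit h ->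
  exp_sum_limit (fun l => g l + h l).
Proof.
move=> Pg Ph S e e0 S0.
have e2 : 0 < e / 2 by rewrite divr_gt0.
have [c c0 gc] := Pg S _ e2 S0; have [d d0 hd] := Ph S _ e2 S0.
exists (c ++ d); first by rewrite /nneg_pairs all_cat; apply/andP.
move=> s sS; rewrite /exp_sum big_cat/= -!/(exp_sum _ s) opprD addrACA.
by rewrite (le_lt_trans (ler_normD _ _))// (splitr e) ltrD// ?gc ?hd.
Qed.

(** The product of two exponential sums is again one: weights multiply and delays add. The rest
    controls the error of the product on the finite set [S]. *)
Lemma exp_sum_limitM g h : exp_sum_limit g -> exp_sum_limit h ->
  exp_sum_limit (fun l => g l * h l).
Proof.
move=> Pg Ph S e e0 S0.
(* On [S], [B - 1] bounds [|g| + |h|], so that [(|g| + |h| + 1) e'] is at most [e / 2]; [e' <= 1]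
   keeps the approximant of [g] within 1 of [g]. *)
pose B := 1 + \sum_(s <- S) (`|g s| + `|h s|).
have gB s : s \in S -> `|g s| + `|h s| <= B - 1.
  move=> sS; rewrite /B [1 + _]addrC addrK (big_rem s)//= lerDl.
  by apply: sumr_ge0 => i _; rewrite addr_ge0.
have B1 : 1 <= B.
  by rewrite lerDl; apply: sumr_ge0 => i _; rewrite addr_ge0.
pose e' := Num.min 1 (e / (2 * B)).
have e'0 : 0 < e' by rewrite lt_min ltr01 divr_gt0//; lra.
have e'1 : e' <= 1 by rewrite ge_min lexx.
have e'e : e' * B <= e / 2.
  rewrite -ler_pdivlMr; last lra.
  rewrite ge_min; apply/orP; right.
  by rewrite invfM mulrA lexx.
have [c c0 gc] := Pg S _ e'0 S0; have [d d0 hd] := Ph S _ e'0 S0.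
exists [seq (p.1 * q.1, p.2 + q.2) | p <- c, q <- d].
  apply/allP => _ /allpairsP[[p q] /= [pc qd ->]] /=.
  have /andP[p1 p2] := allP c0 _ pc; have /andP[q1 q2] := allP d0 _ qd.
  by rewrite mulr_ge0// addr_ge0.
move=> s sS; have -> : exp_sum [seq (p.1 * q.1, p.2 + q.2) | p <- c, q <- d] s
    = exp_sum c s * exp_sum d s.
  rewrite /exp_sum big_allpairs_dep/= mulr_suml; apply: eq_bigr => p _.
  rewrite mulr_sumr; apply: eq_bigr => q _ /=.
  by rewrite mulrDl opprD expRD; ring.
have gcs := gc s sS; have hds := hd s sS; have gs := gB s sS.
have -> : g s * h s - exp_sum c s * exp_sum d s =
  (g s - exp_sum c s) * h s + (g s - (g s - exp_sum c s)) * (h s - exp_sum d s).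
  by ring.
set x := g s - _ in gcs *; set y := h s - _ in hds *.
have x2 : `|g s - x| <= `|g s| + 1.
  by rewrite (le_trans (ler_normB _ _))// lerD2l; lra.
rewrite (le_lt_trans (ler_normD _ _))// !normrM.
have : `|x| * `|h s| <= e' * `|h s| by rewrite ler_wpM2r// ltW.
have : `|g s - x| * `|y| <= (`|g s| + 1) * e'.
  by rewrite ler_pM// ltW.
have hB : (`|g s| + `|h s| + 1) * e' <= B * e' by rewrite ler_wpM2r//; lra.
by lra.
Qed.

Lemma exp_sum_limitZ (k : R) g : 0 <= k -> exp_sum_limit g ->
  exp_sum_limit (fun l => k * g l).
Proof. by move=> /exp_sum_limit_cst; exact: exp_sum_limitM. Qed.

Lemma exp_sum_limitX g n : exp_sum_limit g -> exp_sum_limit (fun l => g l ^+ n).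
Proof.
move=> Pg; elim: n => [|n IH].
  by under eq_fun do rewrite expr0; exact: exp_sum_limit_cst.
by under eq_fun do rewrite exprS; exact: exp_sum_limitM.
Qed.

Lemma exp_sum_limit_sum (g_ : nat -> R -> R) (n : nat) : (forall i, exp_sum_limit (g_ i)) ->
  exp_sum_limit (fun l => \sum_(0 <= i < n) g_ i l).
Proof.
move=> Pg; elim: n => [|n IH].
  by under eq_fun do rewrite big_geq//; exact: exp_sum_limit_cst.
under eq_fun do rewrite big_nat_recr//=.
exact: exp_sum_limitD.
Qed.

(** Only finitely many points are tested at once, and pointwise convergence is uniform on them. This
    is why approximation is asked on finite sets. *)
Lemma exp_sum_limit_cvg (g_ : nat -> R -> R) g :
  (forall n, exp_sum_limit (g_ n)) ->
  (forall s, 0 < s -> g_ n s @[n --> \oo] --> g s) -> exp_sum_limit g.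
Proof.
move=> Pg gg S e e0 S0.
have e2 : 0 < e / 2 by rewrite divr_gt0.
have : \forall n \near \oo, forall s, s \in S -> `|g s - g_ n s| < e / 2.
  elim: S S0 => [|x S IH] S0; first by near=> n.
  have /IH {}IH : forall s, s \in S -> 0 < s.
    by move=> s sS; apply: S0; rewrite inE sS orbT.
  have /cvgrPdist_lt /(_ _ e2) gx := gg x (S0 _ (mem_head _ _)).
  near=> n => s; rewrite inE => /predU1P[->|]; first by near: n.
  by move: s; near: n.
move=> [n _ /(_ n (leqnn n)) gn].
have [c c0 gc] := Pg n S _ e2 S0; exists c => // s sS.
rewrite -(subrKA (g_ n s)) (le_lt_trans (ler_normD _ _))// (splitr e) ltrD//.
- exact: gn.
- exact: gc.
Unshelve. all: by end_near. Qed.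

Lemma eq_exp_sum_limit g h : (forall s, 0 < s -> g s = h s) ->
  exp_sum_limit g -> exp_sum_limit h.
Proof.
move=> gh Pg S e e0 S0; have [c c0 gc] := Pg S _ e0 S0.
by exists c => // s sS; rewrite -gh ?gc// S0.
Qed.

(** Partial sums of the geometric series are polynomials in [g] with nonnegative coefficients, and
    [|g| < 1] makes them converge. *)
Lemma exp_sum_limit_geometric g : exp_sum_limit g ->
  (forall s, 0 < s -> `|g s| < 1) -> exp_sum_limit (fun l => (1 - g l)^-1).
Proof.
move=> Pg g1.
apply: (@exp_sum_limit_cvg (fun n l => \sum_(0 <= i < n) g l ^+ i)).
  by move=> n; apply: exp_sum_limit_sum => i; exact: exp_sum_limitX.
move=> s s0; have := @cvg_geometric_series _ 1 (g s) (g1 s s0).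
rewrite div1r; apply: cvg_trans; apply: near_eq_cvg; near=> n.
by rewrite /series/=; apply: eq_bigr => i _; rewrite /geometric/= mul1r.
Unshelve. all: by end_near. Qed.

End ExpSums.

(** * Ratios of hyperbolic functions at multiples of one angle (gambler's ruin) *)

Section GamblersRuin.
Context {R : realType} (th : R -> R).
Hypothesis th_gt0 : forall l, 0 < l -> 0 < th l.
Hypothesis ch_th : exp_sum_limit (fun l => (ch (th l))^-1).

Local Notation C n l := (ch (n%:R * th l)).
Local Notation S n l := (sh (n%:R * th l)).

(** With [t = ch (th l)], the recurrence [C n.+2 = 2 t C n.+1 - C n] turns the ratio [x] at [n] into
    [(1 / (2 t)) / (1 - x / (2 t))] at [n.+1], a geometric series in a function already in the
    class. *)
Lemma exp_sum_limit_ch_step n : exp_sum_limit (fun l => C n l / C n.+1 l).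
Proof.
elim: n => [|n IH].
  by apply: eq_exp_sum_limit ch_th => s _; rewrite mul0r ch0 !mul1r.
have P1 : exp_sum_limit (fun l => 2^-1 * ((ch (th l))^-1 * (C n l / C n.+1 l))).
  by apply: exp_sum_limitZ; [rewrite invr_ge0|exact: exp_sum_limitM].
have E l : 0 < l -> C n.+1 l * ch (th l) * 2 = C n.+2 l + C n l.
  move=> l0; have -> : n.+2%:R * th l = n.+1%:R * th l + th l.
    by rewrite -[n.+2]addn1 natrD mulrDl mul1r.
  have -> : n%:R * th l = n.+1%:R * th l - th l.
    by rewrite -[in n.+1%:R]addn1 natrD mulrDl mul1r addrK.
  by rewrite chDB -mulrA mulVf// mulr1.
apply: eq_exp_sum_limit (exp_sum_limitM (exp_sum_limitZ (k := 2^-1) _ ch_th)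
  (exp_sum_limit_geometric P1 _)).
- move=> s s0; have := E s s0; have := ch_gt0 (th s).
  have := ch_gt0 (n%:R * th s); have := ch_gt0 (n.+1%:R * th s).
  have := ch_gt0 (n.+2%:R * th s).
  set x := C n.+2 s; set y := C n.+1 s; set z := C n s; set t := ch (th s).
  move=> x0 y0 z0 t0 e; have -> : x = y * t * 2 - z by rewrite e addrK.
  have xx : y * t * 2 - z = x by rewrite e addrK.
  by field; rewrite !gt_eqF//= ?xx// (_ : _ - _ = x)// -xx; ring.
- by rewrite invr_ge0.
- move=> s s0; rewrite ger0_norm; last first.
    apply: mulr_ge0; first by rewrite invr_ge0.
    by apply: mulr_ge0; [|apply: divr_ge0]; rewrite ?invr_ge0; exact/ltW/ch_gt0.
  have y0 : 0 < C n.+1 s by exact: ch_gt0.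
  have t0 := ch_gt0 (th s).
  have -> : 2^-1 * ((ch (th s))^-1 * (C n s / C n.+1 s)) = C n s / (C n.+1 s * ch (th s) * 2).
    by field; rewrite !gt_eqF.
  (* By the recurrence the denominator exceeds [C n s] by the positive number [C n.+2 s], hence the
     ratio of the geometric series is below 1. *)
  rewrite E// ltr_pdivrMr ?mul1r ?ltrDr ?ch_gt0//.
  by apply: addr_gt0; exact: ch_gt0.
Qed.

(** The same recurrence holds for [S]. The induction starts from [S 1 / S 2 = 1 / (2 ch (th l))],
    since [S 0] vanishes. *)
Lemma exp_sum_limit_sh_step n : (0 < n)%N ->
  exp_sum_limit (fun l => S n l / S n.+1 l).
Proof.
have E m l : 0 < l -> S m.+1 l * ch (th l) * 2 = S m.+2 l + S m l.
  move=> l0; have -> : m.+2%:R * th l = m.+1%:R * th l + th l.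
    by rewrite -[m.+2]addn1 natrD mulrDl mul1r.
  have -> : m%:R * th l = m.+1%:R * th l - th l.
    by rewrite -[in m.+1%:R]addn1 natrD mulrDl mul1r addrK.
  by rewrite shD shB; ring.
have S0 m l : 0 < l -> 0 < S m.+1 l by move=> /th_gt0 l0; rewrite sh_gt0 ?mulr_gt0.
case: n => // n _; elim: n => [|n IH].
  apply: eq_exp_sum_limit (exp_sum_limitZ (k := 2^-1) _ ch_th); last by rewrite invr_ge0.
  move=> s s0; have := E 0%N s s0; rewrite mul0r sh0 addr0 => <-.
  by field; rewrite !gt_eqF// ?ch_gt0 ?S0.
have P1 : exp_sum_limit (fun l => 2^-1 * ((ch (th l))^-1 * (S n.+1 l / S n.+2 l))).
  by apply: exp_sum_limitZ; [rewrite invr_ge0|exact: exp_sum_limitM].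
apply: eq_exp_sum_limit (exp_sum_limitM (exp_sum_limitZ (k := 2^-1) _ ch_th)
  (exp_sum_limit_geometric P1 _)).
- move=> s s0; have := E n.+1 s s0; have := ch_gt0 (th s).
  have := S0 n s s0; have := S0 n.+1 s s0; have := S0 n.+2 s s0.
  set x := S n.+3 s; set y := S n.+2 s; set z := S n.+1 s; set t := ch (th s).
  move=> x0 y0 z0 t0 e; have -> : x = y * t * 2 - z by rewrite e addrK.
  have xx : y * t * 2 - z = x by rewrite e addrK.
  by field; rewrite !gt_eqF//= ?xx// (_ : _ - _ = x)// -xx; ring.
- by rewrite invr_ge0.
- move=> s s0; rewrite ger0_norm; last first.
    apply: mulr_ge0; first by rewrite invr_ge0.
    apply: mulr_ge0; first by rewrite invr_ge0; exact/ltW/ch_gt0.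
    by apply: divr_ge0; exact/ltW/S0.
  have y0 : 0 < S n.+2 s by exact: S0.
  have t0 := ch_gt0 (th s).
  have -> : 2^-1 * ((ch (th s))^-1 * (S n.+1 s / S n.+2 s)) =
      S n.+1 s / (S n.+2 s * ch (th s) * 2).
    by field; rewrite !gt_eqF.
  rewrite E// ltr_pdivrMr ?mul1r ?ltrDr ?S0//.
  by apply: addr_gt0; exact: S0.
Qed.

(** Telescoping product of one-step ratios. *)
Lemma exp_sum_limit_ch_ratio m n : (m <= n)%N ->
  exp_sum_limit (fun l => C m l / C n l).
Proof.
elim: n => [|n IH].
  rewrite leqn0 => /eqP ->; apply: eq_exp_sum_limit (exp_sum_limit_cst (k := 1) _) => //.
  by move=> s s0; rewrite divff// gt_eqF ?ch_gt0.
rewrite leq_eqVlt => /predU1P[->|].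
  apply: eq_exp_sum_limit (exp_sum_limit_cst (k := 1) _) => //.
  by move=> s s0; rewrite divff// gt_eqF ?ch_gt0.
rewrite ltnS => /IH /exp_sum_limitM /(_ (exp_sum_limit_ch_step n)).
apply: eq_exp_sum_limit => s s0.
by rewrite -mulrA mulKf// gt_eqF ?ch_gt0.
Qed.

Lemma exp_sum_limit_sh_ratio m n : (m <= n)%N -> (0 < n)%N ->
  exp_sum_limit (fun l => S m l / S n l).
Proof.
case: m => [_ _|m].
  apply: eq_exp_sum_limit (exp_sum_limit_cst (k := 0) _) => //.
  by move=> s s0; rewrite mul0r sh0 mul0r.
have S1 : exp_sum_limit (fun l => S m.+1 l / S m.+1 l).
  apply: eq_exp_sum_limit (exp_sum_limit_cst (k := 1) _) => //.
  by move=> s s0; rewrite divff// gt_eqF// sh_gt0// mulr_gt0 ?th_gt0.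
elim: n => // n IH; rewrite leq_eqVlt => /predU1P[<-//|].
rewrite ltnS => mn _; have n0 : (0 < n)%N by exact: leq_ltn_trans mn.
have := exp_sum_limitM (IH mn n0) (exp_sum_limit_sh_step n0).
apply: eq_exp_sum_limit => s s0.
by rewrite -mulrA mulKf// gt_eqF// sh_gt0// mulr_gt0 ?th_gt0 ?ltr0n.
Qed.

(** For [j <= i], [2 C i C j = C (i + j) + C (i - j)], and neither index exceeds [n]. *)
Lemma exp_sum_limit_chM_ratio i j n : (i + j <= n)%N ->
  exp_sum_limit (fun l => C i l * C j l / C n l).
Proof.
wlog ji : i j / (j <= i)%N => [wl|ijn].
  have [|/ltnW ij] := leqP j i; first exact: wl.
  rewrite addnC => /(wl _ _ ij); apply: eq_exp_sum_limit => s _.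
  by rewrite [C j s * _]mulrC.
have h : exp_sum_limit (fun l => 2^-1 * (C (i + j) l / C n l + C (i - j) l / C n l)).
  apply: exp_sum_limitZ; first by rewrite invr_ge0.
  by apply: exp_sum_limitD; apply: exp_sum_limit_ch_ratio; lia.
apply: eq_exp_sum_limit h => s _; rewrite chDB natrD natrB// mulrDl mulrBl.
by field; rewrite gt_eqF ?ch_gt0.
Qed.

(* Peeling off [m] steps at a time, [sh (q + m) = sh q ch m + ch q sh m]
   produces only nonnegative terms, until the numerator is below [m]. *)
Lemma exp_sum_limit_sh_shch p m n i : (0 < m)%N -> (i + p <= n)%N ->
  exp_sum_limit (fun l => C i l * S p l / (S m l * C n l)).
Proof.
move=> m0; have [k] := ubnP p; elim: k => // k IH in p i *.
rewrite ltnS => pk ipn; have [pm|mp] := leqP p m.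
  have := exp_sum_limitM (exp_sum_limit_sh_ratio pm m0)
    (exp_sum_limit_ch_ratio (leq_trans (leq_addr p i) ipn)).
  by apply: eq_exp_sum_limit => s _; rewrite [(S m s * _)^-1]invfM; ring.
have mS l : 0 < l -> S m l != 0.
  by move=> l0; rewrite gt_eqF// sh_gt0// mulr_gt0 ?th_gt0 ?ltr0n.
have [q qE] : exists q, p = (q + m)%N by exists (p - m)%N; lia.
have Q j : (j + q <= n)%N -> exp_sum_limit (fun l => C j l * S q l / (S m l * C n l)).
  by apply: IH; lia.
(* The term [ch q sh m] of the peeled sum: [S m] cancels and leaves a product of two cosines. *)
have A := exp_sum_limit_chM_ratio (_ : i + q <= n)%N.
have B : exp_sum_limit (fun l => C i l * C m l * S q l / (S m l * C n l)).
  (* [C i C m] splits into [C (i + m)] and [C |i - m|], which is why the induction hypothesis is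
     stated for any leading index. Maximum minus minimum is [|i - m|] in the natural numbers. *)
  have h : exp_sum_limit (fun l => 2^-1 *
      (C (i + m) l * S q l / (S m l * C n l) +
       C (maxn i m - minn i m) l * S q l / (S m l * C n l))).
    apply: exp_sum_limitZ; first by rewrite invr_ge0.
    by apply: exp_sum_limitD; apply: Q; lia.
  apply: eq_exp_sum_limit h => s s0; rewrite chDB natrD mulrDl.
  have -> : C (maxn i m - minn i m) s = ch (i%:R * th s - m%:R * th s).
    have [im|/ltnW mi] := leqP i m; last by rewrite natrB// mulrBl.
    by rewrite natrB// mulrBl -opprB chN.
  by field; rewrite gt_eqF ?ch_gt0//= mS.
have iqn : (i + q <= n)%N by lia.
apply: eq_exp_sum_limit (exp_sum_limitD (A iqn) B) => s s0.
rewrite qE natrD mulrDl shD.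
by field; rewrite gt_eqF ?ch_gt0//= mS.
Qed.

End GamblersRuin.

(** * Inverse hyperbolic cosine and the diffusive scaling of the random walk *)

Section RandomWalkLimit.
Context {R : realType}.
Implicit Types (a b l u x : R) (n : nat).

(** Both bounds come from [1 + y <= exp y] at [y = x] and [y = - x]. *)
Lemma sh_bounds x : 0 <= x -> x * expR (- x) <= sh x <= x * expR x.
Proof.
move=> x0; have px := expR_ge1Dx x; have nx := expR_ge1Dx (- x).
have e0 := expR_gt0 x; have E := expRxMexpNx_1 x.
set e := expR x in px e0 E *; set f := expR (- x) in nx E *.
have f0 : 0 < f by exact: expR_gt0.
have f1 : f <= 1 by rewrite expR_le1 oppr_le0.
have e1 : e * (1 - x) <= 1 by rewrite -[leRHS]E ler_pM2l.
have fx : f * (1 + x) <= 1 by rewrite -[leRHS]E mulrC ler_pM2r.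
have xf : x * f <= x by rewrite ler_piMr.
have xe : x <= x * e by rewrite ler_peMr// -expR0 ler_expR.
rewrite /sh -/e -/f ler_pdivlMr// ler_pdivrMr//.
apply/andP; split; lra.
Qed.

(* [arch u] is the inverse hyperbolic cosine of [expR u]. *)
Definition arch_sh u : R := Num.sqrt ((expR u - 1) / 2).
Definition arch u : R :=
  2 * ln (arch_sh u + Num.sqrt (1 + arch_sh u ^+ 2)).

(** With the upper bound that follows, [arch_sh u] is equivalent to [sqrt (u / 2)] near 0; the two
    rest on [u <= exp u - 1 <= u exp u]. *)
Lemma arch_sh_ge u : 0 <= u -> Num.sqrt (u / 2) <= arch_sh u.
Proof.
move=> u0; rewrite /arch_sh ler_sqrt; last first.
  by rewrite divr_ge0// subr_ge0 -expR0 ler_expR.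
by rewrite ler_pM2r// lerBrDl expR_ge1Dx.
Qed.

Lemma arch_sh_le u : 0 <= u -> arch_sh u <= Num.sqrt (u / 2) * expR (u / 2).
Proof.
move=> u0.
have -> : expR (u / 2) = Num.sqrt (expR u).
  rewrite (splitr u) expRD -expr2 sqrtr_sqr ger0_norm ?expR_ge0//.
  by rewrite -splitr.
rewrite -sqrtrM ?divr_ge0// ler_sqrt; last first.
  by rewrite mulr_ge0 ?expR_ge0 ?divr_ge0.
rewrite mulrAC ler_pM2r// mulrC.
have := expR_ge1Dx (- u); have := expRxMexpNx_1 u; have := expR_gt0 u.
set e := expR u; set f := expR (- u) => e0 E h.
have : e * (1 - u) <= 1 by rewrite -[leRHS]E ler_pM2l.
by lra.
Qed.

(** Since [ch v - 1 = 2 sh (v / 2) ^ 2], [arch_sh u] is [sh (arch u / 2)]; and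
    [ln (y + sqrt (1 + y ^ 2))] is the inverse hyperbolic sine of [y]. *)
Lemma ch_arch u : 0 <= u -> ch (arch u) = expR u.
Proof.
move=> u0; have y2 : arch_sh u ^+ 2 = (expR u - 1) / 2.
  by rewrite sqr_sqrtr// divr_ge0// subr_ge0 -expR0 ler_expR.
have y0 : 0 <= arch_sh u by exact: sqrtr_ge0.
rewrite /arch; set y := arch_sh u in y0 y2 *; set r := Num.sqrt _.
have r2 : r ^+ 2 = 1 + y ^+ 2 by rewrite sqr_sqrtr// addr_ge0// sqr_ge0.
have r0 : 0 < r by rewrite sqrtr_gt0 ltr_wpDr ?sqr_ge0.
have yr : 0 < y + r by rewrite ltr_wpDl.
rewrite /ch expRN [2 * _]mulrC -[2]/(2%:R) expRM_natr lnK ?posrE//.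
have -> : ((y + r) ^+ 2)^-1 = (r - y) ^+ 2.
  apply: (@mulfI _ ((y + r) ^+ 2)); first by rewrite sqrf_eq0 gt_eqF.
  rewrite divff ?sqrf_eq0 ?gt_eqF// -exprMn.
  by rewrite (_ : (y + r) * (r - y) = r ^+ 2 - y ^+ 2); [rewrite r2 addrK expr1n|ring].
have -> : expR u = 1 + 2 * y ^+ 2 by rewrite y2; field.
have -> : (y + r) ^+ 2 + (r - y) ^+ 2 = 2 * (r ^+ 2 + y ^+ 2) by ring.
by rewrite r2; field.
Qed.

(** For [r = sqrt (1 + y ^ 2)] one has [1 <= r <= 1 + y ^ 2 / 2]; combine with
    [z / (1 + z) <= ln (1 + z) <= z]. Hence [arch u] is equivalent to [2 arch_sh u] near 0. *)
Lemma arch_bounds u : 0 <= u ->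
  2 * arch_sh u / (1 + arch_sh u) <= arch u <= 2 * arch_sh u + arch_sh u ^+ 2.
Proof.
move=> u0; have y0 : 0 <= arch_sh u by exact: sqrtr_ge0.
rewrite /arch; set y := arch_sh u in y0 *; set r := Num.sqrt _.
have r2 : r ^+ 2 = 1 + y ^+ 2 by rewrite sqr_sqrtr// addr_ge0// sqr_ge0.
have r0 : 0 < r by rewrite sqrtr_gt0 ltr_wpDr ?sqr_ge0.
have r1 : 1 <= r by rewrite -[leLHS]sqrtr1 ler_wsqrtr// lerDl sqr_ge0.
have ry : r <= 1 + y ^+ 2 / 2.
  have Y := sqr_ge0 y.
  rewrite -ler_sqr ?nnegrE ?(ltW r0)//; last by lra.
  rewrite r2; have := sqr_ge0 (y ^+ 2); lra.
have yr : 0 < y + r by rewrite ltr_wpDl.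
apply/andP; split.
  rewrite -mulrA ler_pM2l//.
  have y1 : 0 < 1 + y by rewrite ltr_wpDr.
  rewrite (@le_trans _ _ (ln (1 + y)))//; last by rewrite ler_ln ?posrE//; lra.
  rewrite -[ln _]opprK -lnV ?posrE// lerNr.
  have yE : (1 + y)^-1 = 1 + - (y / (1 + y)) by field; rewrite gt_eqF.
  rewrite [X in ln X]yE; apply: le_ln1Dx; rewrite ltrN2 ltr_pdivrMr//; lra.
have -> : y + r = 1 + (y + r - 1) by ring.
have h : ln (1 + (y + r - 1)) <= y + r - 1 by apply: le_ln1Dx; lra.
by lra.
Qed.

Lemma arch_gt0 u : 0 < u -> 0 < arch u.
Proof.
move=> u0; have /andP[+ _] := arch_bounds (ltW u0); apply: lt_le_trans.
have y0 : 0 < arch_sh u.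
  by apply: lt_le_trans (arch_sh_ge (ltW u0)); rewrite sqrtr_gt0 divr_gt0.
by rewrite divr_gt0 ?mulr_gt0// addr_gt0.
Qed.

Let invn_cvg0 : (n.+1%:R^-1 : R) @[n --> \oo] --> (0 : R).
Proof. exact: cvg_harmonic. Qed.

(** With [N = n.+1], [1 / ch (walk_angle n l)] is the single exponential [exp (- l / (2 N ^ 2))]: a
    walk of mesh [1 / N] makes one step per time [1 / (2 N ^ 2)]. *)
Definition walk_angle n l : R := arch (l / 2 * n.+1%:R^-1 ^+ 2).

(** With [u = l / (2 N ^ 2)], the equivalents chain up: [arch u], [2 arch_sh u],
    [2 sqrt (u / 2) = sqrt l / N]. *)
Lemma walk_angle_cvg l : 0 < l ->
  n.+1%:R * walk_angle n l @[n --> \oo] --> Num.sqrt l.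
Proof.
move=> l0; pose u n : R := l / 2 * n.+1%:R^-1 ^+ 2.
have u0 n : 0 <= u n by rewrite mulr_ge0 ?sqr_ge0// divr_ge0// ltW.
have u_cvg : u n @[n --> \oo] --> (0 : R).
  suff : u n @[n --> \oo] --> l / 2 * (0 * 0) by rewrite mul0r mulr0.
  apply: cvgM; first exact: cvg_cst.
  by under eq_fun do rewrite expr2; apply: cvgM.
have squ n : Num.sqrt (u n / 2) = Num.sqrt l / 2 / n.+1%:R.
  rewrite /u; set N := n.+1%:R^-1.
  rewrite (_ : _ / 2 = l * (2^-1 * N) ^+ 2); last by field.
  rewrite sqrtrM ?ltW// sqrtr_sqr ger0_norm ?mulrA// mulr_ge0 ?invr_ge0//.
have y_cvg : n.+1%:R * arch_sh (u n) @[n --> \oo] --> Num.sqrt l / 2.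
  apply: (@squeeze_cvgr _ _ _ _ (fun=> Num.sqrt l / 2)
    (fun n => Num.sqrt l / 2 * expR (u n / 2))).
  - apply: nearW => n; apply/andP; split.
      rewrite [leRHS]mulrC -ler_pdivrMr ?ltr0n// -squ.
      exact: arch_sh_ge.
    rewrite [leLHS]mulrC -ler_pdivlMr ?ltr0n// mulrAC -squ.
    exact: arch_sh_le.
  - exact: cvg_cst.
  - suff : Num.sqrt l / 2 * expR (u n / 2) @[n --> \oo] -->
        Num.sqrt l / 2 * expR (0 / 2) by rewrite mul0r expR0 mulr1.
    apply: cvgM; first exact: cvg_cst.
    apply: continuous_cvg; first exact: continuous_expR.
    by apply: cvgM => //; exact: cvg_cst.
have y_cvg0 : arch_sh (u n) @[n --> \oo] --> (0 : R).
  rewrite -(mul0r (Num.sqrt l / 2)).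
  rewrite (_ : (fun n => _) = (fun n => n.+1%:R^-1 * (n.+1%:R * arch_sh (u n)))).
    exact: cvgM.
  by apply/funext => n; rewrite mulKf// pnatr_eq0.
apply: (@squeeze_cvgr _ _ _ _
   (fun n => 2 * (n.+1%:R * arch_sh (u n)) / (1 + arch_sh (u n)))
   (fun n => 2 * (n.+1%:R * arch_sh (u n)) +
             n.+1%:R * arch_sh (u n) * arch_sh (u n))).
- apply: nearW => n; have /andP[h1 h2] := arch_bounds (u0 n).
  have n0 : (0 : R) < n.+1%:R by rewrite ltr0n.
  apply/andP; split.
    by rewrite mulrCA -mulrA ler_pM2l.
  rewrite (_ : _ + _ = n.+1%:R * (2 * arch_sh (u n) + arch_sh (u n) ^+ 2)); last by ring.
  by rewrite ler_pM2l.
- rewrite (_ : Num.sqrt l = 2 * (Num.sqrt l / 2) / (1 + 0)); last by field.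
  apply: cvgM; first by apply: cvgM => //; exact: cvg_cst.
  apply: cvgV; first by rewrite addr0 oner_neq0.
  by apply: cvgD => //; exact: cvg_cst.
- rewrite (_ : Num.sqrt l = 2 * (Num.sqrt l / 2) + Num.sqrt l / 2 * 0); last by field.
  by apply: cvgD; apply: cvgM => //; exact: cvg_cst.
Qed.

(** * The contraction factor of one sweep: complete monotonicity and bounds *)

Definition dnwr_factor a b l : R :=
  sh ((b - a) * Num.sqrt l) / (sh (a * Num.sqrt l) * ch (b * Num.sqrt l)).

Lemma truncn_cvg a : 0 < a ->
  (Num.truncn (a * n.+1%:R))%:R / n.+1%:R @[n --> \oo] --> a.
Proof.
move=> a0; apply: (@squeeze_cvgr _ _ _ _ (fun n => a - n.+1%:R^-1) (fun=> a)).
- apply: nearW => n; have n0 : (0 : R) < n.+1%:R by rewrite ltr0n.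
  have : 0 <= a * n.+1%:R by rewrite mulr_ge0 ?ltW.
  move=> /truncn_itv /andP[h1 h2]; apply/andP; split.
    rewrite ler_pdivlMr// mulrBl mulVf ?gt_eqF// lerBlDr natr1.
    exact: ltW.
  by rewrite ler_pdivrMr.
- rewrite -[X in _ --> X]subr0; apply: cvgB => //; exact: cvg_cst.
- exact: cvg_cst.
Qed.

Lemma exp_sum_limit_dnwr_factor a b : 0 < a -> a < b ->
  exp_sum_limit (dnwr_factor a b).
Proof.
move=> a0 ab; have b0 := lt_trans a0 ab.
(* [p], [m] and [q] are the mesh counts for [b - a], [a] and [b]. The successor keeps [m] positive,
   and defining [q] as [m + p] makes [p <= q] hold exactly. *)
pose p n := Num.truncn ((b - a) * n.+1%:R).
pose m n := (Num.truncn (a * n.+1%:R)).+1.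
pose q n := (m n + p n)%N.
have p_cvg : (p n)%:R / n.+1%:R @[n --> \oo] --> b - a.
  by apply: truncn_cvg; rewrite subr_gt0.
have m_cvg : (m n)%:R / n.+1%:R @[n --> \oo] --> a.
  rewrite -[X in _ --> X]addr0; under eq_fun do rewrite /m -natr1 mulrDl mul1r.
  by apply: cvgD => //; exact: truncn_cvg.
have q_cvg : (q n)%:R / n.+1%:R @[n --> \oo] --> b.
  rewrite -[X in _ --> X](subrKC a); under eq_fun do rewrite /q natrD mulrDl.
  exact: cvgD.
have angle_cvg (k : nat -> nat) (c l : R) : 0 < l ->
    (k n)%:R / n.+1%:R @[n --> \oo] --> c ->
    (k n)%:R * walk_angle n l @[n --> \oo] --> c * Num.sqrt l.
  move=> l0 kc; rewrite (_ : (fun n => _) =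
     (fun n => (k n)%:R / n.+1%:R * (n.+1%:R * walk_angle n l))).
    by apply: cvgM => //; exact: walk_angle_cvg.
  by apply/funext => n; rewrite -mulrA mulKf// pnatr_eq0.
pose g n l := sh ((p n)%:R * walk_angle n l) /
  (sh ((m n)%:R * walk_angle n l) * ch ((q n)%:R * walk_angle n l)).
apply: (@exp_sum_limit_cvg _ g) => [n|l l0].
- have u0 l : 0 < l -> 0 < l / 2 * n.+1%:R^-1 ^+ 2.
    by move=> l0; rewrite mulr_gt0 ?divr_gt0// exprn_gt0// invr_gt0 ltr0n.
  have th0 l : 0 < l -> 0 < walk_angle n l by move=> /u0/arch_gt0.
  have thP : exp_sum_limit (fun l => (ch (walk_angle n l))^-1).
    have c0 : (0 : R) <= 2^-1 * n.+1%:R^-1 ^+ 2 by rewrite mulr_ge0 ?sqr_ge0 ?invr_ge0.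
    apply: eq_exp_sum_limit (exp_sum_limit_expR c0) => l l0.
    rewrite /walk_angle ch_arch ?(ltW (u0 _ _))// -expRN; congr expR.
    by congr (- _); ring.
  have := exp_sum_limit_sh_shch th0 thP (p := p n) (m := m n) (n := q n) (i := 0).
  move=> /(_ erefl); rewrite add0n /q leq_addl => /(_ erefl).
  by apply: eq_exp_sum_limit => l l0; rewrite mul0r ch0 mul1r.
- apply: cvgM.
    apply: continuous_cvg; [exact: sh_continuous|exact: angle_cvg].
  apply: cvgV.
    by rewrite mulf_neq0// gt_eqF ?ch_gt0// sh_gt0// mulr_gt0// sqrtr_gt0.
  apply: cvgM.
    by apply: continuous_cvg; [exact: sh_continuous|exact: angle_cvg].
  by apply: continuous_cvg; [exact: ch_continuous|exact: angle_cvg].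
Qed.

Lemma dnwr_factor_gt0 a b l : 0 < a -> a < b -> 0 < l -> 0 < dnwr_factor a b l.
Proof.
move=> a0 ab l0; rewrite /dnwr_factor.
have s0 : 0 < Num.sqrt l by rewrite sqrtr_gt0.
have h x : 0 < x -> 0 < sh (x * Num.sqrt l) by move=> x0; rewrite sh_gt0// mulr_gt0.
apply: divr_gt0; first by rewrite h ?subr_gt0.
by apply: mulr_gt0; [exact: h|exact: ch_gt0].
Qed.

(** Uses [sh x <= x exp x] in the numerator, [x exp (- x) <= sh x] and [1 <= ch x] in the
    denominator. The bound tends to [(b - a) / a] as [l] tends to 0. *)
Lemma dnwr_factor_le a b l : 0 < a -> a < b -> 0 < l ->
  dnwr_factor a b l <= (b - a) / a * expR (b * Num.sqrt l).
Proof.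
move=> a0 ab l0; have s0 : 0 < Num.sqrt l by rewrite sqrtr_gt0.
have ba : 0 < b - a by rewrite subr_gt0.
rewrite /dnwr_factor; set s := Num.sqrt l in s0 *.
have /andP[_ h1] := sh_bounds (ltW (mulr_gt0 ba s0)).
have /andP[h2 _] := sh_bounds (ltW (mulr_gt0 a0 s0)).
have as0 : 0 < sh (a * s) by rewrite sh_gt0// mulr_gt0.
have c1 : 1 <= ch (b * s).
  by apply/ltW/ch_gt1; rewrite mulr_gt0// (lt_trans a0).
have e0 := expR_gt0 (- (a * s)).
rewrite ler_pdivrMr; last by rewrite mulr_gt0// ch_gt0.
rewrite (le_trans h1)//.
have -> : expR (b * s) = expR ((b - a) * s) * expR (a * s).
  by rewrite -expRD; congr expR; ring.
apply: (@le_trans _ _ ((b - a) / a * (expR ((b - a) * s) * expR (a * s)) *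
                       (a * s * expR (- (a * s)) * 1))).
  rewrite expRN (_ : _ * (_ * _ * 1) = (b - a) * s * expR ((b - a) * s))//.
  by field; rewrite !gt_eqF ?expR_gt0.
apply: ler_wpM2l.
  by rewrite !mulr_ge0 ?expR_ge0 ?invr_ge0 ?ltW.
by apply: ler_pM => //; rewrite ?mulr_ge0 ?ltW.
Qed.

(** With [r = sqrt l], [A = exp (- 2 a r)] and [B = exp (- 2 b r)], the factor equals
    [2 (A - B) / ((1 - A) (1 + B))], and [A - B <= A (1 + B)]. *)
Lemma dnwr_factor_le_expR a b l : 0 < a -> a < b -> 0 < l ->
  dnwr_factor a b l <=
    2 * expR (- (2 * a * Num.sqrt l)) / (1 - expR (- (2 * a * Num.sqrt l))).
Proof.
move=> a0 ab l0; have s0 : 0 < Num.sqrt l by rewrite sqrtr_gt0.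
have b0 := lt_trans a0 ab; have ba : 0 < b - a by rewrite subr_gt0.
rewrite /dnwr_factor; set s := Num.sqrt l in s0 *.
have E1 : expR (- (2 * a * s)) < 1 by rewrite expR_lt1 oppr_lt0 !mulr_gt0.
have E2 := expR_gt0 (- (2 * a * s)).
have B2 := expR_gt0 (- (2 * b * s)).
have AB : expR (- (2 * b * s)) <= expR (- (2 * a * s)).
  by rewrite ler_expR lerN2 ler_pM2r// ler_pM2l// ltW.
have -> : sh ((b - a) * s) / (sh (a * s) * ch (b * s)) =
  2 * (expR (- (2 * a * s)) - expR (- (2 * b * s))) /
    ((1 - expR (- (2 * a * s))) * (1 + expR (- (2 * b * s)))).
  have x0 := expR_gt0 (a * s); have y0 := expR_gt0 (b * s).
  rewrite /sh /ch (_ : expR (- (2 * a * s)) = (expR (a * s) ^+ 2)^-1); last first.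
    by rewrite -expRM_natl -expRN; congr expR; ring.
  rewrite (_ : expR (- (2 * b * s)) = (expR (b * s) ^+ 2)^-1); last first.
    by rewrite -expRM_natl -expRN; congr expR; ring.
  rewrite [(b - a) * s]mulrBl opprB !expRD !expRN.
  have x1 : 1 < expR (a * s) by rewrite expR_gt1 mulr_gt0.
  by field; rewrite !gt_eqF//= subr_gt0 exprn_egt1.
rewrite invfM mulrA ler_pdivrMr; last by lra.
rewrite [leRHS]mulrAC ler_pM2r ?invr_gt0 ?subr_gt0//.
have : 0 <= expR (- (2 * a * s)) * expR (- (2 * b * s)) by rewrite mulr_ge0 ?ltW.
lra.
Qed.

End RandomWalkLimit.

(** * The transformed subdomain problems at a real frequency *)

Section TransformedHeat.
Context {R : realType}.
Implicit Types (u : R -> R) (l r c s : R).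

Lemma derive_eq0_cst_oo l r (f : R -> R) :
  (forall x, x \in `]l, r[ -> is_derive x 1 f 0) ->
  forall x y, x \in `]l, r[ -> y \in `]l, r[ -> f x = f y.
Proof.
move=> df; suff h x y : x \in `]l, r[ -> y \in `]l, r[ -> x < y -> f x = f y.
  move=> x y xI yI; have [xy|yx|->//] := ltgtP x y; first exact: h.
  by apply/esym/h.
rewrite !in_itv/= => /andP[lx xr] /andP[ly yr] xy.
have sub z : x <= z <= y -> z \in `]l, r[.
  move=> /andP[xz zy]; rewrite in_itv/= (lt_le_trans lx xz)/=.
  exact: le_lt_trans yr.
have dfxy z : z \in `]x, y[ -> is_derive z 1 f ((cst 0 : R -> R) z).
  rewrite in_itv/= => /andP[xz zy]; apply: df; apply: sub.
  by rewrite !ltW.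
have [|z _] := MVT xy dfxy.
  apply: derivable_within_continuous => z; rewrite in_itv/= => /sub /df.
  by case.
by rewrite mul0r => /eqP; rewrite subr_eq0 => /eqP.
Qed.

(** For [c = s] and [c = - s], [(u' + c u) exp (- c x)] is a first integral of [u'' = s ^ 2 u]. The
    two together eliminate [u'] and give [u] inside; one-sided continuity extends the formula to the
    endpoints. *)
Lemma heat_ode_solution u l r s : l < r -> 0 < s -> C2_oo_cont l r u ->
  {in `]l, r[, forall x, s ^+ 2 * u x = (u^`(2))%classic x} ->
  exists A B, forall x, x \in `[l, r] ->
    u x = A * expR (s * x) + B * expR (- s * x).
Proof.
move=> lr s0 [[du ul ur] ddu] ode.
have cst c : c ^+ 2 = s ^+ 2 -> forall x y, x \in `]l, r[ -> y \in `]l, r[ ->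
    (u^`()%classic x + c * u x) * expR (- c * x) =
    (u^`()%classic y + c * u y) * expR (- c * y).
  move=> cs; apply: derive_eq0_cst_oo => x xI.
  have d1 : is_derive x 1 u (u^`()%classic x).
    by apply: DeriveDef; [exact: du|rewrite derive1E].
  have d2 : is_derive x 1 (u^`()%classic : R -> R) (s ^+ 2 * u x).
    by apply: DeriveDef; [exact: ddu|rewrite -derive1E; exact/esym/ode].
  have dl : is_derive x 1 (fun y : R => - c * y) (- c).
    apply: (is_derive_eq (is_deriveZ (- c) (is_derive_id x 1))).
    exact: mulr1.
  have d3 := is_derive1_comp (is_derive_expR (- c * x)) dl.
  have d4 := is_deriveM (is_deriveD d2 (is_deriveZ c d1)) d3.
  by apply: (is_derive_eq d4); rewrite !fctE /GRing.scale/= /GRing.scale/= -cs; ring.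
(* Up to the factor [2 s] and a sign, [A] and [B] are the first integrals evaluated at the
   midpoint. *)
pose m := (l + r) / 2.
have mI : m \in `]l, r[ by rewrite in_itv/=; apply/andP; split; rewrite /m; lra.
pose A := (u^`()%classic m + s * u m) * expR (- s * m) / (2 * s).
pose B := - ((u^`()%classic m + - s * u m) * expR (s * m) / (2 * s)).
have E x : x \in `]l, r[ -> u x = A * expR (s * x) + B * expR (- s * x).
  move=> xI; have := cst s erefl _ _ mI xI; have := cst (- s) (sqrrN s) _ _ mI xI.
  rewrite /A /B opprK => -> ->; rewrite mulNr expRN.
  by field; rewrite !gt_eqF ?expR_gt0.
exists A, B.
have cF : continuous (fun x => A * expR (s * x) + B * expR (- s * x)).
  have ce c : continuous (fun x : R => expR (c * x)).
    move=> x; apply: continuous_comp; last exact: continuous_expR.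
    exact: mulrl_continuous.
  by move=> x; apply: cvgD; apply: cvgM; (exact: cvg_cst || exact: ce).
move=> x; rewrite in_itv/= !le_eqVlt => /andP[/predU1P[<-|lx] /predU1P[xr|xr]].
- by move: lr; rewrite xr ltxx.
- apply: (@cvg_unique _ _ (u @ l^'+)) => //=.
  apply: cvg_trans (cvg_at_right_filter (cF l)).
  apply: near_eq_cvg; near=> z; rewrite E// in_itv/=; apply/andP; split.
    by near: z; exact: nbhs_right_gt.
  by near: z; exact: nbhs_right_lt.
- rewrite xr; apply: (@cvg_unique _ _ (u @ r^'-)) => //=.
  apply: cvg_trans (cvg_at_left_filter (cF r)).
  apply: near_eq_cvg; near=> z; rewrite E// in_itv/=; apply/andP; split.
    by near: z; exact: nbhs_left_gt.
  by near: z; exact: nbhs_left_lt.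
- by apply: E; rewrite in_itv/= lx.
Unshelve. all: by end_near. Qed.

Lemma expR_combination_derive (A B s : R) :
  is_derive (0 : R) 1 (fun x : R => A * expR (s * x) + B * expR (- s * x)) (s * (A - B)).
Proof.
have d (C c : R) : is_derive (0 : R) 1 (fun x : R => C * expR (c * x)) (C * c).
  have dl : is_derive (0 : R) 1 (fun y : R => c * y) c.
    apply: (is_derive_eq (is_deriveZ c (is_derive_id (0 : R) 1))).
    exact: mulr1.
  have d3 := is_derive1_comp (is_derive_expR (c * 0)) dl.
  apply: (is_derive_eq (is_deriveZ C d3)).
  by rewrite mulr0 expR0 mul1r.
by apply: (is_derive_eq (is_deriveD (d A s) (d B (- s)))); ring.
Qed.

(** At a real frequency the real parts decouple. With [r = sqrt l], the Neumann solve returns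
    [- coth (a r) tanh (b r)] times the old trace, and [1 - coth (a r) tanh (b r)] is minus the
    contraction factor. *)
Lemma sweep_factor (a b l : R) (g g' : R[i]) (u1 u2 : R -> R[i]) :
  0 < a -> a < b -> 0 < l ->
  dnwr_sweep a b (1 / 2) (l%:C)%C g u1 u2 g' ->
  complex.Re g' = - (1 / 2) * dnwr_factor a b l * complex.Re g.
Proof.
move=> a0 ab l0 [[C1 _ ode1] out1 dir1 [C2 _ ode2] [d [[left1 _] [right2 _]]] out2 upd].
have b0 := lt_trans a0 ab.
pose s := Num.sqrt l; have s0 : 0 < s by rewrite sqrtr_gt0.
have s2 : s ^+ 2 = l by rewrite sqr_sqrtr// ltW.
have reE (u : R -> R[i]) x : (l%:C)%C * u x - dxx u x = 0 ->
    s ^+ 2 * re_part u x = ((re_part u)^`(2))%classic x.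
  rewrite s2 /re_part /dxx; case: (u x) => ux vx /= [].
  rewrite mul0r subr0 => /eqP; rewrite subr_eq0 => /eqP-> _.
  by [].
have Na0 : - a < 0 by rewrite oppr_lt0.
have [A1 [B1 E1]] := heat_ode_solution Na0 s0 C1 (fun x xI => reE _ _ (ode1 x xI)).
have [A2 [B2 E2]] := heat_ode_solution b0 s0 C2 (fun x xI => reE _ _ (ode2 x xI)).
(* The exponential formulas hold up to the interface, so the one-sided quotients of [u1] and [u2] at
   0 are those of functions differentiable there. *)
have quot A B : h^-1 * ((A * expR (s * h) + B * expR (- s * h)) -
    (A * expR (s * 0) + B * expR (- s * 0))) @[h --> (0 : R)^'] --> s * (A - B).
  have [+ <-] := expR_combination_derive A B s.
  rewrite /derivable /derive => /cvgP /=; apply: cvg_trans.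
  apply: near_eq_cvg; near=> h.
  by rewrite /= addr0 [h%:A]mulr1.
have dE1 : complex.Re d = s * (A1 - B1).
  rewrite -(cvg_lim (@Rhausdorff R) left1); apply: cvg_lim => //.
  apply: cvg_trans (cvg_dnbhs_at_left (quot A1 B1)).
  apply: near_eq_cvg; near=> h; rewrite add0r !E1//.
    by rewrite in_itv/= lexx ltW.
  rewrite in_itv/=; apply/andP; split.
    by apply/ltW; near: h; exact: nbhs_left_gt.
  by near: h; exact: nbhs_left_le.
have dE2 : complex.Re d = s * (A2 - B2).
  rewrite -(cvg_lim (@Rhausdorff R) right2); apply: cvg_lim => //.
  apply: cvg_trans (cvg_dnbhs_at_right (quot A2 B2)).
  apply: near_eq_cvg; near=> h; rewrite add0r !E2//.
    by rewrite in_itv/= lexx ltW.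
  rewrite in_itv/=; apply/andP; split.
    by near: h; exact: nbhs_right_ge.
  by apply/ltW; near: h; exact: nbhs_right_lt.
have Reg : complex.Re g = A1 + B1.
  rewrite -dir1 -/(re_part u1 0) E1 ?in_itv/= ?lexx ?andbT ?ltW//.
  by rewrite !mulr0 expR0 !mulr1.
have Reu2 : re_part u2 0 = A2 + B2.
  by rewrite E2 ?in_itv/= ?lexx ?ltW// !mulr0 expR0 !mulr1.
have out1' : A1 * expR (s * - a) + B1 * expR (- s * - a) = 0.
  by rewrite -E1 ?in_itv/= ?lexx ?ltW// /re_part out1.
have out2' : A2 * expR (s * b) + B2 * expR (- s * b) = 0.
  by rewrite -E2 ?in_itv/= ?lexx ?andbT ?ltW// /re_part out2.
have -> : complex.Re g' = (1 / 2) * re_part u2 0 + (1 - 1 / 2) * complex.Re g.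
  rewrite upd /re_part; case: (u2 0) => ux vx; case: (g) => gx gy /=.
  by rewrite !mul0r !subr0.
rewrite Reu2 Reg /dnwr_factor -/s.
have x1 : 1 < expR (a * s) by rewrite expR_gt1 mulr_gt0.
have y0 := expR_gt0 (b * s).
rewrite /sh /ch [(b - a) * s]mulrBl opprB !expRD !expRN.
move: out1' out2'; rewrite !mulrN !mulNr opprK [s * a]mulrC [s * b]mulrC !expRN.
move: x1 y0; set x := expR (a * s); set y := expR (b * s) => x1 y0 o1 o2.
have x0 : 0 < x by exact: lt_trans x1.
have AB : A1 - B1 = A2 - B2 by apply: (@mulfI _ s); rewrite ?gt_eqF// -dE1.
(* The outer conditions and the common slope express the other three coefficients through [B1]. *)
have A1E : A1 = - B1 * x ^+ 2.
  apply: (@mulIf _ x^-1); first by rewrite invr_eq0 gt_eqF.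
  by move: o1 => /(canRL (addrK _)) ->; field; rewrite gt_eqF.
have B2E : B2 = - A2 * y ^+ 2.
  apply: (@mulIf _ y^-1); first by rewrite invr_eq0 gt_eqF.
  by move: o2 => /(canRL (addKr _)) ->; field; rewrite gt_eqF.
have y2 : 0 < 1 + y ^+ 2 by rewrite ltr_pwDl ?sqr_ge0.
have A2E : A2 = - B1 * (1 + x ^+ 2) / (1 + y ^+ 2).
  apply: (@mulIf _ (1 + y ^+ 2)); rewrite ?gt_eqF// mulfVK ?gt_eqF//.
  transitivity (A2 - B2); first by rewrite B2E; ring.
  by rewrite -AB A1E; ring.
rewrite B2E A2E A1E.
by field; apply/and4P; split; rewrite gt_eqF// -expr2 ?subr_gt0 ?exprn_egt1// addrC.
Unshelve. all: by end_near. Qed.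

End TransformedHeat.

(** * Pointwise sign from integrals against polynomials in [exp (- t)] *)

Section Density.
Context {R : realType}.
Local Notation mu := (@lebesgue_measure R).

(** Lebesgue differentiation: the primitive of [w] is nondecreasing on the positive half-line and
    has derivative [w] almost everywhere. *)
Lemma integrable_ge0_ae (w : R -> R) : mu.-integrable setT (EFin \o w) ->
  (forall x y, 0 < x -> x < y -> 0 <= \int[mu]_(t in `]x, y]) w t) ->
  {ae mu, forall x, 0 < x -> 0 <= w x}.
Proof.
move=> iw w0.
have iwS (A : set R) : measurable A -> mu.-integrable A (EFin \o w).
  by move=> mA; apply: integrableS iw.
have locw : locally_integrable [set: R] w.
  rewrite -(patch_setT (fun=> 0) w).
  exact: integrable_locally_restrict.
have := FTC1Ny (fun y => iwS _ (measurable_itv `]-oo, y])) locw.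
apply: filterS; first exact: (ae_filter_ringOfSetsType mu).
move=> x [dF <-] x0.
rewrite derive1E; apply: limr_ge; first exact: dF.
near=> h => /=; rewrite [h%:A]mulr1.
have incr y z : 0 < y -> y < z ->
    0 <= \int[mu]_(t in `]-oo, z]) w t - \int[mu]_(t in `]-oo, y]) w t.
  move=> y0 yz; rewrite Rintegral_itvB ?bnd_simp ?(ltW yz)//; first exact: w0.
  exact: iwS.
have h0 : h != 0 by near: h; exact: nbhs_dnbhs_neq.
have xh : 0 < h + x.
  have : `|h| < x by near: h; exact: dnbhs0_lt.
  by rewrite ltr_norml => /andP[? _]; lra.
have [hlt|hgt|/eqP] := ltgtP h 0; last by rewrite (negbTE h0).
- rewrite /GRing.scale/= -mulrNN -invrN opprB mulr_ge0//.
    by rewrite invr_ge0 oppr_ge0 ltW.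
  by apply: incr => //; lra.
- by rewrite /GRing.scale/= mulr_ge0 ?invr_ge0 ?(ltW hgt)// incr// ltrDr.
Unshelve. all: by end_near. Qed.

(** A polynomial step at [c] with values in [0, 1] on [0, 1]: the exponent [K] is about [c ^ (- n)],
    so [K x ^ n] is about [(x / c) ^ n], which tends to 0 for [x < c] and to infinity for
    [x > c]. *)
Definition bump (c : R) n : {poly R} :=
  (1 - 'X^n) ^+ (Num.truncn (c^-1 ^+ n)).+1.

Lemma bump_itv c n x : 0 <= x <= 1 -> 0 <= (bump c n).[x] <= 1.
Proof.
move=> /andP[x0 x1]; rewrite /bump !hornerE.
have xn0 : 0 <= x ^+ n by rewrite exprn_ge0.
have xn1 : x ^+ n <= 1 by rewrite exprn_ile1.
by rewrite exprn_ge0 ?exprn_ile1//; lra.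
Qed.

Lemma bernoulli_ge (y : R) k : 0 <= y <= 1 -> 1 - k%:R * y <= (1 - y) ^+ k.
Proof.
move=> /andP[y0 y1]; elim: k => [|k IH]; first by rewrite mul0r subr0 expr0.
have y2 : 0 <= 1 - y by lra.
rewrite exprS; apply: le_trans (ler_wpM2l y2 IH); rewrite -natr1.
have : 0 <= k%:R * y ^+ 2 by rewrite mulr_ge0 ?sqr_ge0.
nra.
Qed.

(** Induction through [(1 - y) (1 + (k + 1) y) <= 1 + k y]. It makes [(1 - y) ^ k] small once [k y]
    is large. *)
Lemma bernoulli_le (y : R) k : 0 <= y <= 1 -> (1 - y) ^+ k * (1 + k%:R * y) <= 1.
Proof.
move=> /andP[y0 y1]; elim: k => [|k IH]; first by rewrite mul0r addr0 expr0 mulr1.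
apply: le_trans IH; rewrite exprSr -mulrA ler_wpM2l//.
  by rewrite exprn_ge0//; lra.
have : 0 <= k%:R * y ^+ 2 by rewrite mulr_ge0 ?sqr_ge0.
have : 0 <= y ^+ 2 by rewrite sqr_ge0.
rewrite -natr1; nra.
Qed.

Lemma bump_cvg1 c x : 0 < c < 1 -> 0 <= x < c ->
  (bump c n).[x] @[n --> \oo] --> (1 : R).
Proof.
move=> /andP[c0 c1] /andP[x0 xc].
have xc1 : `|x / c| < 1.
  by rewrite ger0_norm ?divr_ge0 ?(ltW c0)// ltr_pdivrMr// mul1r.
have x1 : `|x| < 1 by rewrite ger0_norm// (lt_trans xc).
apply: (@squeeze_cvgr _ _ _ _ (fun n => 1 - ((x / c) ^+ n + x ^+ n)) (fun=> 1)).
- apply: nearW => n.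
  have xI : 0 <= x <= 1 by rewrite x0 ltW// (lt_trans xc).
  have /andP[_ ->] := bump_itv c n xI; rewrite andbT /bump !hornerE.
  have xn : 0 <= x ^+ n <= 1.
    by case/andP: xI => ? ?; rewrite exprn_ge0 ?exprn_ile1.
  apply: le_trans (bernoulli_ge _ xn); rewrite lerD2l lerN2.
  rewrite -natr1 mulrDl mul1r lerD2r exprMn mulrC ler_wpM2l ?exprn_ge0//.
  by rewrite truncn_le ?exprn_ge0 ?invr_ge0 ?ltW.
- rewrite -[X in _ --> X]subr0; apply: cvgB; first exact: cvg_cst.
  by rewrite -[X in _ --> X]addr0; apply: cvgD; exact: cvg_expr.
- exact: cvg_cst.
Qed.

Lemma bump_cvg0 c x : 0 < c -> c < x <= 1 ->
  (bump c n).[x] @[n --> \oo] --> (0 : R).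
Proof.
move=> c0 /andP[cx x1]; have x0 := lt_trans c0 cx.
have xc1 : `|c / x| < 1.
  by rewrite ger0_norm ?divr_ge0 ?(ltW c0) ?(ltW x0)// ltr_pdivrMr// mul1r.
have xI : 0 <= x <= 1 by rewrite x1 ltW.
apply: (@squeeze_cvgr _ _ _ _ (fun=> 0) (fun n => (c / x) ^+ n)).
- apply: nearW => n; have /andP[-> _] := bump_itv c n xI; rewrite /bump !hornerE/=.
  set k := _.+1.
  have xn : 0 <= x ^+ n <= 1 by rewrite exprn_ge0 ?exprn_ile1// ltW.
  have kc : (c^-1 ^+ n <= k%:R).
    by apply/ltW; have /truncn_itv/andP[] : 0 <= c^-1 ^+ n by rewrite exprn_ge0 ?invr_ge0 ?ltW.
  rewrite -[c / x]invrK invf_div exprVn -[leRHS]div1r ler_pdivlMr; last first.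
    by rewrite exprn_gt0 ?divr_gt0.
  apply: le_trans (bernoulli_le k xn).
  rewrite ler_wpM2l ?exprn_ge0//; first by rewrite subr_ge0; case/andP: xn.
  rewrite exprMn mulrC.
  have : c^-1 ^+ n * x ^+ n <= k%:R * x ^+ n by rewrite ler_wpM2r// exprn_ge0// ltW.
  lra.
- exact: cvg_cst.
- exact: cvg_expr.
Qed.

Local Notation pos := (`]0, +oo[%classic : set R).

Lemma measurable_pos : measurable (pos : set (measurableTypeR R)).
Proof. exact: measurable_itv. Qed.

Lemma continuous_horner_expR (p : {poly R}) :
  continuous (fun t : R => p.[expR (- t)]).
Proof.
move=> t; apply: (@continuous_comp _ _ _ (fun t : R => expR (- t)) (horner p)).
  2: exact: continuous_horner.
apply: continuous_comp; last exact: continuous_expR.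
exact: oppr_continuous.
Qed.

Lemma measurable_horner_expR (p : {poly R}) (A : set R) :
  measurable_fun A (fun t : R => p.[expR (- t)]).
Proof.
apply: measurable_funTS; apply: continuous_measurable_fun.
exact: continuous_horner_expR.
Qed.

Lemma expRN_itv (t : R) : 0 <= t -> 0 <= expR (- t) <= 1.
Proof. by move=> t0; rewrite expR_ge0 -expR0 ler_expR oppr_le0. Qed.

Lemma integrable_horner_expR (p : {poly R}) (w : R -> R) :
  mu.-integrable pos (EFin \o w) ->
  mu.-integrable pos (EFin \o (fun t => p.[expR (- t)] * w t)).
Proof.
move=> iw; have := @integrableMr _ _ _ mu pos _ (fun t : R => p.[expR (- t)]) (EFin \o w).
apply => //; first exact: measurable_horner_expR.
exists (\sum_(i < size p) `|p`_i|); split; first exact: num_real.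
move=> M pM t /=; rewrite in_itv/= andbT => t0; apply: ltW; apply: le_lt_trans pM.
rewrite horner_coef; apply: le_trans (ler_norm_sum _ _ _) _.
apply: ler_sum => i _; rewrite normrM ler_piMr// normrX.
have /andP[e0 e1] := expRN_itv (ltW t0).
by rewrite ger0_norm// exprn_ile1.
Qed.

(** Polynomials in [exp (- t)], bounded by 1, converge almost everywhere to the indicator of []x,
    y]]. Dominated convergence makes the integral of [w] over []x, y]] nonnegative. *)
Lemma horner_expR_ge0_ae (w : R -> R) : mu.-integrable pos (EFin \o w) ->
  (forall p : {poly R}, (forall x, 0 <= x <= 1 -> 0 <= p.[x]) ->
    0 <= \int[mu]_(t in pos) (p.[expR (- t)] * w t)) ->
  {ae mu, forall t, 0 < t -> 0 <= w t}.
Proof.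
move=> iw w0; pose v := w \_ pos.
have iv : mu.-integrable setT (EFin \o v).
  by rewrite /v -restrict_EFin -integrable_mkcond//; exact: measurable_itv.
suff : {ae mu, forall t, 0 < t -> 0 <= v t}.
  apply: filterS; first exact: (ae_filter_ringOfSetsType mu).
  move=> t vt t0; have := vt t0; rewrite /v patchE mem_set//=.
  by rewrite in_itv/= t0.
apply: integrable_ge0_ae => // x y x0 xy; have y0 := lt_trans x0 xy.
(* As [exp (- t)] decreases in [t], the first factor tends to the indicator of [t > x] and the
   second to that of [t < y]. *)
pose p n := bump (expR (- x)) n * (1 - bump (expR (- y)) n).
have pE n z : (p n).[z] =
    (bump (expR (- x)) n).[z] * (1 - (bump (expR (- y)) n).[z]).
  by rewrite hornerM hornerD hornerN hornerC.
have pI n z : 0 <= z <= 1 -> 0 <= (p n).[z] <= 1.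
  move=> zI; rewrite pE.
  have /andP[a0 a1] := bump_itv (expR (- x)) n zI.
  have /andP[b0 b1] := bump_itv (expR (- y)) n zI.
  by apply/andP; split; [apply: mulr_ge0|apply: mulr_ile1] => //; lra.
have subpos : `]x, y]%classic `<=` pos.
  by move=> t /=; rewrite !in_itv/= andbT => /andP[xt _]; exact: lt_trans xt.
pose f_ n (t : R) := ((p n).[expR (- t)] * w t)%:E.
pose f (t : R) := ((w \_ `]x, y]%classic) t)%:E.
have fI : mu.-integrable setT f.
  rewrite (_ : f = (EFin \o w) \_ `]x, y]%classic).
    by rewrite -integrable_mkcond//; exact: integrableS iw.
  by rewrite restrict_EFin.
have [|||||_ _] := @dominated_convergence _ _ _ mu pos (measurable_itv _) f_ f
  (abse \o (EFin \o w)).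
- by move=> n; apply: (measurable_int mu); exact: integrable_horner_expR.
- by apply: (measurable_int mu); exact: integrableS fI.
(* The limit of the bumps is not controlled at the two jumps, which form a null set. *)
- exists [set x; y]; split.
  + exact: measurableU.
  + by apply: null_set_setU => //; exact: lebesgue_measure_set1.
  move=> t; apply: contrapT => /not_implyP[t0 nt].
  apply: t0; rewrite /= in_itv/= andbT => t0.
  have tx : t != x by apply/eqP => tx; apply: nt; left.
  have ty : t != y by apply/eqP => ty; apply: nt; right.
  have xE : 0 < expR (- x) < 1 by rewrite expR_gt0 expR_lt1 oppr_lt0.
  have yE : 0 < expR (- y) < 1 by rewrite expR_gt0 expR_lt1 oppr_lt0.
  have tE : expR (- t) <= 1 by rewrite expR_le1 oppr_le0 ltW.
  have pt : (p n).[expR (- t)] @[n --> \oo] --> ((t \in `]x, y]%classic)%:R : R).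
    have below z : t < z -> 0 < z ->
        (bump (expR (- z)) n).[expR (- t)] @[n --> \oo] --> (0 : R).
      by move=> tz z0; apply: bump_cvg0; rewrite ?expR_gt0// tE ltr_expR ltrN2 tz.
    have above z : z < t -> 0 < z ->
        (bump (expR (- z)) n).[expR (- t)] @[n --> \oo] --> (1 : R).
      move=> zt z0; apply: bump_cvg1; rewrite ?expR_gt0 ?expR_lt1 ?oppr_lt0//.
      by rewrite expR_ge0 ltr_expR ltrN2 zt.
    under eq_fun do rewrite pE.
    have [{}tx|{}tx] : t < x \/ x < t by apply/orP; rewrite -neq_lt.
      rewrite memNset; last by rewrite /= in_itv/= ltNge (ltW tx).
      suff : (bump (expR (- x)) n).[expR (- t)] *
         (1 - (bump (expR (- y)) n).[expR (- t)]) @[n --> \oo] --> (0 * (1 - 0) : R).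
        by rewrite mul0r.
      apply: cvgM; first exact: below.
      by apply: cvgB; [exact: cvg_cst|exact: below (lt_trans tx xy) _].
    have [{}ty|{}ty] : t < y \/ y < t by apply/orP; rewrite -neq_lt.
      rewrite mem_set; last by rewrite /= in_itv/= tx ltW.
      suff : (bump (expR (- x)) n).[expR (- t)] *
         (1 - (bump (expR (- y)) n).[expR (- t)]) @[n --> \oo] --> (1 * (1 - 0) : R).
        by rewrite mul1r subr0.
      apply: cvgM; first exact: above.
      by apply: cvgB; [exact: cvg_cst|exact: below].
    rewrite memNset; last by rewrite /= in_itv/= andbC leNgt ty.
    suff : (bump (expR (- x)) n).[expR (- t)] *
       (1 - (bump (expR (- y)) n).[expR (- t)]) @[n --> \oo] --> (1 * (1 - 1) : R).
      by rewrite subrr mulr0.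
    apply: cvgM; first exact: above.
    by apply: cvgB; [exact: cvg_cst|exact: above].
  have -> : f t = ((t \in `]x, y]%classic)%:R * w t)%:E.
    by rewrite /f patchE; case: ifP => _; rewrite ?mul1r ?mul0r.
  apply: cvg_EFin; first by apply: nearW.
  by apply: cvgM => //; exact: cvg_cst.
- exact: integrable_abse.
- apply: nearW => t n; rewrite /= in_itv/= andbT => t0.
  rewrite /f_ /= lee_fin normrM ler_piMl//.
  by have /andP[h0 h1] := pI n _ (expRN_itv (ltW t0)); rewrite ger0_norm.
have -> : (\int[mu]_(t in pos) f t = (\int[mu]_(t in `]x, y]) v t)%:E)%E.
  rewrite /Rintegral fineK; last first.
    by apply: integrable_fin_num => //; exact: integrableS iv.
  rewrite (_ : f = (EFin \o w) \_ `]x, y]%classic); last by rewrite restrict_EFin.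
  rewrite -integral_mkcondr setIidr//; apply: eq_integral => t txy.
  by rewrite /v/= patchE mem_set//; apply: subpos; exact: set_mem.
move=> lim; rewrite -lee_fin; apply: cvge_ge lim; apply: nearW => n /=.
have -> : (\int[mu]_(t in pos) f_ n t =
           (\int[mu]_(t in pos) ((p n).[expR (- t)] * w t))%:E)%E.
  rewrite /Rintegral fineK//.
  by apply: integrable_fin_num => //; exact: integrable_horner_expR.
by rewrite lee_fin; apply: w0 => z zI; have /andP[] := pI n z zI.
Qed.

End Density.

(** * The Laplace transform at real frequencies; translations of the half-line *)

Section RealLaplace.
Context {R : realType}.
Local Notation mu := (@lebesgue_measure R).
Local Notation pos := (`]0, +oo[%classic : set R).
Implicit Types (f h : R -> R) (s u : R).

Definition lap f s : R := \int[mu]_(t in pos) (expR (- (s * t)) * f t).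

Definition lap_integrable f := forall s, 0 < s ->
  mu.-integrable pos (EFin \o (fun t => expR (- (s * t)) * f t)).

Lemma posE t : pos t = (0 < t) :> Prop.
Proof. by rewrite /= in_itv/= andbT. Qed.

Lemma integrable_expR s : 0 < s ->
  mu.-integrable pos (EFin \o (fun t => expR (- (s * t)))).
Proof.
move=> s0; have i0 : mu.-integrable pos (EFin \o exponential_pdf s).
  by apply: integrableS (integrable_exponential_pdf s0).
have := integrableZl measurable_pos s^-1 i0.
apply: eq_integrable => // t; rewrite inE posE => t0 /=.
rewrite /exponential_pdf patchE mem_set; last by rewrite /= in_itv/= ltW.
by rewrite -EFinM mulKf ?gt_eqF// mulNr.
Qed.

Lemma measurable_expR_scale s (A : set R) :
  measurable_fun A (fun t : R => expR (- (s * t))).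
Proof.
apply: measurable_funTS; apply: continuous_measurable_fun => t.
apply: continuous_comp; last exact: continuous_expR.
apply: continuous_comp; last exact: oppr_continuous.
exact: mulrl_continuous.
Qed.

Lemma lap_integrable_bounded h C : measurable_fun pos h ->
  {ae mu, forall t, 0 < t -> `|h t| <= C} -> lap_integrable h.
Proof.
move=> mh hC s s0; apply/integrableP.
have mF : measurable_fun pos (fun t => expR (- (s * t)) * h t).
  by apply: measurable_funM => //; exact: measurable_expR_scale.
split; first exact/measurable_EFinP.
have iC := integrableZl measurable_pos C (integrable_expR s0).
have /integrableP[mC] := iC; apply: le_lt_trans.
apply: ae_ge0_le_integral => //.
- by apply: measurableT_comp => //; exact/measurable_EFinP.
- exact: measurableT_comp.
- apply: filterS hC; first exact: (ae_filter_ringOfSetsType mu).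
  move=> t hC; rewrite /= in_itv/= andbT => /hC {}hC.
  rewrite lee_fin [C * _]mulrC !normrM ler_wpM2l//.
  by rewrite (le_trans hC)// ler_norm.
Qed.

Lemma integrable_expRN_bounded (M : R -> R) C : measurable_fun setT M ->
  (forall t, 0 <= M t) -> (forall t, M t <= C) ->
  mu.-integrable pos (EFin \o (fun t => expR (- t) * M t)).
Proof.
move=> mM M0 MC; have : lap_integrable M.
  apply: (@lap_integrable_bounded _ C); first exact: measurable_funTS.
  by apply: nearW => t _; rewrite ger0_norm.
move=> /(_ 1 ltr01); apply: eq_integrable => // t _ /=.
by rewrite mul1r.
Qed.

(** Frequencies in arithmetic progression of step 1 turn a combination of transforms into the
    integral of [f] against [exp (- s t)] times a polynomial in [exp (- t)]. *)
Lemma lap_sum f s n (c : nat -> R) : lap_integrable f -> 0 < s ->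
  mu.-integrable pos (EFin \o
    (fun t => (\sum_(i < n) c i * expR (- ((s + i%:R) * t))) * f t)) /\
  \sum_(i < n) c i * lap f (s + i%:R) =
  \int[mu]_(t in pos) ((\sum_(i < n) c i * expR (- ((s + i%:R) * t))) * f t).
Proof.
move=> fi s0; elim: n => [|n [IH1 IH2]].
  rewrite big_ord0 (_ : EFin \o _ = cst 0%E); last first.
    by apply/funext => t /=; rewrite big_ord0 mul0r.
  split; first exact: integrable0.
  rewrite (@eq_Rintegral _ _ _ mu pos (cst 0)) ?Rintegral_cst ?mul0r// => t _ /=.
  by rewrite big_ord0 mul0r.
have sn : 0 < s + n%:R by rewrite ltr_wpDr.
have i1 := integrableZl measurable_pos (c n) (fi _ sn).
split.
  have := integrableD measurable_pos IH1 i1.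
  apply: eq_integrable => // t _ /=.
  rewrite big_ord_recr/= -EFinM -EFinD; congr EFin.
  by set S := \sum_(i < n) _; ring.
rewrite big_ord_recr/= IH2 /lap -RintegralZl//; last exact: fi.
rewrite -RintegralD//.
by apply: eq_Rintegral => t _; rewrite big_ord_recr/=; set S := \sum_(i < n) _; ring.
Qed.

Local Notation mR := (measurableTypeR R).

Lemma measurable_shift u :
  measurable_fun setT ((fun v : R => u + v) : mR -> mR).
Proof.
apply: continuous_measurable_fun => v.
by apply: cvgD; [exact: cvg_cst|exact: cvg_id].
Qed.

Let shift u : {mfun mR >-> mR} :=
  HB.pack ((fun v : R => u + v) : mR -> mR)
    (isMeasurableFun.Build _ _ _ _ _ (measurable_shift u)).

(** Translation preserves the length of half-open intervals, and these determine the measure. *)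
Lemma lebesgue_measure_shift u (A : set mR) : measurable A ->
  mu A = pushforward mu (shift u) A.
Proof.
apply: (@lebesgue_measure_unique R (pushforward mu (shift u))).
move=> _ [[x y] _ <-]; transitivity (mu `]x - u, y - u]).
  by rewrite !lebesgue_measure_itv/= !lte_fin ltrD2r -!EFinB opprB addrA subrK.
congr (mu _); apply/seteqP.
by split => t /=; rewrite !in_itv/= ltrBlDl lerBrDl.
Qed.

Lemma ge0_integral_shift_le (g : R -> R) u : 0 <= u -> measurable_fun setT g ->
  (forall t, 0 <= g t) ->
  (\int[mu]_(v in pos) (g (u + v))%:E <= \int[mu]_(t in pos) (g t)%:E)%E.
Proof.
move=> u0 mg g0.
have mgE (A : set R) : measurable_fun A (EFin \o g).
  by apply/measurable_EFinP; exact: measurable_funTS.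
have -> : (\int[mu]_(v in pos) (g (u + v))%:E = \int[mu]_(t in `]u, +oo[) (g t)%:E)%E.
  rewrite [RHS](@eq_measure_integral _ _ _ _ (pushforward mu (shift u))); last first.
    by move=> A mA _; exact: lebesgue_measure_shift.
  rewrite (ge0_integral_pushforward (measurable_shift u))//; last 2 first.
  - exact: mgE.
  - by move=> y _; rewrite lee_fin.
  have domE (A : set mR) : A = pos -> (\int[mu]_(v in pos) (g (u + v))%:E =
      \int[mu]_(v in A) (g (u + v))%:E)%E by move=> ->.
  by apply: domE; apply/seteqP; split => t /=; rewrite !in_itv/= !andbT ltrDl.
apply: ge0_subset_integral => //.
- exact: mgE.
- by move=> x _; rewrite lee_fin.
- by move=> t /=; rewrite !in_itv/= !andbT; exact: le_lt_trans.
Qed.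

End RealLaplace.

(** * Comparison with a monotone bound, tested against one polynomial *)

Section Comparison.
Context {R : realType}.
Local Notation mu := (@lebesgue_measure R).
Local Notation pos := (`]0, +oo[%classic : set R).

Variables (h M : R -> R) (C sg : R).
Hypothesis mh : measurable_fun pos h.
Hypothesis mM : measurable_fun setT M.
Hypothesis M_ge0 : forall t, 0 <= M t.
Hypothesis M_le : forall t, M t <= C.
Hypothesis M_homo : {homo M : s t / s <= t}.
Hypothesis hM : {ae mu, forall t, 0 < t -> `|h t| <= M t}.
Hypothesis sg_gt0 : 0 < sg.

Let lap_integrable_h : lap_integrable h.
Proof.
apply: (@lap_integrable_bounded _ _ C) => //.
apply: filterS hM; first exact: (ae_filter_ringOfSetsType mu).
by move=> t hMt t0; rewrite (le_trans (hMt t0)).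
Qed.

Let integrable_M : mu.-integrable pos (EFin \o (fun t => expR (- t) * M t)).
Proof. exact: integrable_expRN_bounded mM M_ge0 M_le. Qed.

Variable p : {poly R}.
Hypothesis p_ge0 : forall x, 0 <= x <= 1 -> 0 <= p.[x].

Let X := \int[mu]_(t in pos) (p.[expR (- t)] * (expR (- t) * M t)).

(** The 1 supplies a factor [exp (- t)] that makes [M] integrable, [sg] is the point where [g] gets
    evaluated, and [i] is the power of [exp (- t)]. *)
Let freq i : R := (1 + sg) + i%:R.

Let freq_gt0 i : 0 < freq i.
Proof. by rewrite /freq ltr_pwDl// ltr_pwDl// ltW. Qed.

Let testE (t : R) : \sum_(i < size p) p`_i * expR (- (freq i * t)) =
  p.[expR (- t)] * expR (- t) * expR (- (sg * t)).
Proof.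
rewrite horner_coef -mulrA mulr_suml; apply: eq_bigr => i _.
rewrite -expRM_natl -!mulrA -!expRD; congr (_ * expR _).
by rewrite /freq; ring.
Qed.

(** The factor [exp (- u s)] is a delay: put [t = u + v]. Then [exp (- sg t) <= exp (- sg u)], and
    [|h v| <= M v <= M t] because [M] is nondecreasing. *)
Let shifted_test_le u : 0 <= u ->
  `|\sum_(i < size p) p`_i * expR (- (u * freq i)) * lap h (freq i)| <=
  expR (- (u * sg)) * X.
Proof.
move=> u0; have sg1 : 0 < 1 + sg by rewrite ltr_wpDl.
have [I ->] := lap_sum (size p) (fun i => p`_i * expR (- (u * freq i)))
  lap_integrable_h sg1.
(* The absolute value keeps [exp] in [0, 1], so that [psi] is nonnegative on the whole line. *)
pose psi t := p.[expR (- `|t|)] * (expR (- `|t|) * M t).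
have psi0 t : 0 <= psi t.
  by rewrite !mulr_ge0 ?expR_ge0// p_ge0// expRN_itv.
have mpsi : measurable_fun setT psi.
  apply: measurable_funM; last apply: measurable_funM => //.
  - apply: continuous_measurable_fun => t.
    apply: (@continuous_comp _ _ _ (@Num.norm _ R) (fun t : R => p.[expR (- t)])).
      exact: norm_continuous.
    exact: continuous_horner_expR.
  - apply: continuous_measurable_fun => t.
    apply: (@continuous_comp _ _ _ (@Num.norm _ R) (fun t : R => expR (- t))).
      exact: norm_continuous.
    apply: continuous_comp; last exact: continuous_expR.
    exact: oppr_continuous.
have ipsi : mu.-integrable pos (EFin \o psi).
  apply: eq_integrable (integrable_horner_expR p integrable_M) => // t.
  by rewrite inE posE => t0 /=; rewrite /psi gtr0_norm.
have XE : X%:E = (\int[mu]_(t in pos) (psi t)%:E)%E.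
  rewrite /X /Rintegral fineK; last first.
    by apply: integrable_fin_num => //; exact: integrable_horner_expR.
  apply: eq_integral => t; rewrite inE posE => t0.
  by rewrite /psi gtr0_norm.
rewrite -lee_fin EFin_normr_Rintegral// EFinM XE.
apply: le_trans (le_abse_integral mu measurable_pos (measurable_int mu I)) _.
have mshift : measurable_fun setT (fun v => psi (u + v)).
  apply: measurableT_comp => //; exact: measurable_shift.
have mshiftE : measurable_fun pos (fun v => (psi (u + v))%:E).
  by apply/measurable_EFinP; exact: measurable_funTS.
apply: (@le_trans _ _ (\int[mu]_(v in pos)
    ((expR (- (u * sg)))%:E * (psi (u + v))%:E))%E); last first.
  rewrite ge0_integralZl_EFin ?expR_ge0//; last by move=> t _; rewrite lee_fin.
  by apply: lee_wpmul2l; rewrite ?lee_fin ?expR_ge0//; exact: ge0_integral_shift_le.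
apply: ae_ge0_le_integral => //.
- by apply: measurableT_comp => //; exact: measurable_int I.
- by move=> t _; rewrite -EFinM lee_fin mulr_ge0// expR_ge0.
- exact: measurable_funeM.
apply: filterS hM; first exact: (ae_filter_ringOfSetsType mu).
move=> v hMv; rewrite /= in_itv/= andbT => v0; rewrite lee_fin.
have uv : 0 < u + v by rewrite ltr_wpDl.
have -> : \sum_(i < size p) p`_i * expR (- (u * freq i)) *
    expR (- ((1 + sg + i%:R) * v)) =
    p.[expR (- (u + v))] * expR (- (u + v)) * expR (- (sg * (u + v))).
  rewrite -testE; apply: eq_bigr => i _; rewrite -mulrA -expRD.
  by congr (_ * expR _); rewrite /freq; ring.
have P0 : 0 <= p.[expR (- (u + v))] * expR (- (u + v)).
  by rewrite mulr_ge0 ?expR_ge0// p_ge0// expRN_itv// ltW.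
rewrite normrM (ger0_norm (mulr_ge0 P0 (expR_ge0 _))) /psi (gtr0_norm uv).
have -> : expR (- (u * sg)) * (p.[expR (- (u + v))] * (expR (- (u + v)) * M (u + v))) =
    p.[expR (- (u + v))] * expR (- (u + v)) * (expR (- (u * sg)) * M (u + v)) by ring.
rewrite -[leLHS]mulrA ler_wpM2l//.
apply: ler_pM => //; rewrite ?expR_ge0//.
  rewrite ler_expR lerN2 mulrC ler_wpM2l ?(ltW sg_gt0)// lerDl ltW//.
by rewrite (le_trans (hMv v0))// M_homo// lerDr.
Qed.

(** For an exponential sum, add the delay estimates with their weights: the sum of [exp (- u sg)]
    rebuilds the value at [sg]. A general [g] costs an error [e (X + Y)], with [e] arbitrary. *)
Lemma lap_test_le (g : R -> R) : exp_sum_limit g ->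
  `|\sum_(i < size p) p`_i * (g (freq i) * lap h (freq i))| <= g sg * X.
Proof.
move=> Pg; pose Y := \sum_(i < size p) `|p`_i * lap h (freq i)|.
have Y0 : 0 <= Y by apply: sumr_ge0.
have X0 : 0 <= X.
  apply: Rintegral_ge0 => t; rewrite posE => t0.
  by rewrite !mulr_ge0 ?expR_ge0// p_ge0// expRN_itv// (ltW t0).
suff bound e : 0 < e ->
    `|\sum_(i < size p) p`_i * (g (freq i) * lap h (freq i))| <=
    g sg * X + e * (X + Y).
  apply/ler_addgt0Pr => e e0.
  have XY : 0 < X + Y + 1 by rewrite ltr_wpDl// addr_ge0.
  have /bound/le_trans : 0 < e / (X + Y + 1) by rewrite divr_gt0.
  apply; rewrite lerD2l mulrAC ler_pdivrMr// ler_wpM2l ?(ltW e0)//.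
  by rewrite lerDl.
move=> e0.
(* Only the values of [g] at [sg] and at the tested frequencies occur, a finite set. *)
have [|c c0 gc] := Pg (sg :: [seq freq i | i <- iota 0 (size p)]) e e0.
  move=> s; rewrite inE => /predU1P[->//|/mapP[i _ ->]]; exact: freq_gt0.
have gcf (i : 'I_(size p)) : `|g (freq i) - exp_sum c (freq i)| < e.
  apply: gc; rewrite inE; apply/orP; right.
  by apply: map_f; rewrite mem_iota/= add0n ltn_ord.
have gcs : `|g sg - exp_sum c sg| < e by apply: gc; rewrite mem_head.
have H1 : `|\sum_(i < size p) p`_i * (exp_sum c (freq i) * lap h (freq i))| <=
    exp_sum c sg * X.
  have -> : \sum_(i < size p) p`_i * (exp_sum c (freq i) * lap h (freq i)) =
    \sum_(q <- c) q.1 * \sum_(i < size p) p`_i * expR (- (q.2 * freq i)) * lap h (freq i).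
    under [RHS]eq_bigr do rewrite mulr_sumr.
    rewrite exchange_big/=; apply: eq_bigr => i _.
    rewrite /exp_sum mulr_suml mulr_sumr; apply: eq_bigr => q _; ring.
  apply: le_trans (ler_norm_sum _ _ _) _.
  rewrite /exp_sum mulr_suml; rewrite [leLHS]big_seq [leRHS]big_seq.
  apply: ler_sum => q qc; have /andP[q1 q2] := allP c0 _ qc.
  by rewrite normrM ger0_norm// -mulrA ler_wpM2l// shifted_test_le.
have H2 : `|\sum_(i < size p)
    p`_i * ((g (freq i) - exp_sum c (freq i)) * lap h (freq i))| <= e * Y.
  apply: le_trans (ler_norm_sum _ _ _) _.
  rewrite /Y mulr_sumr; apply: ler_sum => i _.
  by rewrite mulrCA normrM ler_wpM2r// ltW.
have -> : \sum_(i < size p) p`_i * (g (freq i) * lap h (freq i)) =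
    \sum_(i < size p) p`_i * (exp_sum c (freq i) * lap h (freq i)) +
    \sum_(i < size p) p`_i * ((g (freq i) - exp_sum c (freq i)) * lap h (freq i)).
  by rewrite -big_split/=; apply: eq_bigr => i _; ring.
rewrite (le_trans (ler_normD _ _))// mulrDr addrA lerD// (le_trans H1)//.
rewrite -mulrDl ler_wpM2r//.
by move: gcs; rewrite ltr_norml => /andP[? ?]; lra.
Qed.

End Comparison.

(** * Pointwise bounds on the iterates *)

Section DNWR.
Context {R : realType}.
Local Notation mu := (@lebesgue_measure R).
Local Notation pos := (`]0, +oo[%classic : set R).

(** The polynomial tests show that [K exp (- t) M] plus or minus [exp (- (1 + sg) t) f] integrates
    nonnegatively against all nonnegative polynomials in [exp (- t)], hence is nonnegative almost
    everywhere. *)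
Lemma laplace_comparison (h M f g : R -> R) (C sg kappa : R) :
  measurable_fun pos h -> measurable_fun setT M ->
  (forall t, 0 <= M t) -> (forall t, M t <= C) -> {homo M : s t / s <= t} ->
  {ae mu, forall t, 0 < t -> `|h t| <= M t} -> 0 < sg ->
  exp_sum_limit g -> lap_integrable f ->
  (forall s, 0 < s -> lap f s = kappa * (g s * lap h s)) ->
  {ae mu, forall t, 0 < t -> `|f t| <= `|kappa| * g sg * (expR (sg * t) * M t)}.
Proof.
move=> mh mM M0 MC Mh hM sg0 Pg fi fE.
have sg1 : 0 < 1 + sg by rewrite ltr_wpDl.
pose K := `|kappa| * g sg.
have iM := integrable_expRN_bounded mM M0 MC.
pose F t := expR (- ((1 + sg) * t)) * f t.
pose w e t := K * (expR (- t) * M t) - e * F t.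
have iw e : mu.-integrable pos (EFin \o w e).
  have := integrableB measurable_pos (integrableZl measurable_pos K iM)
    (integrableZl measurable_pos e (fi _ sg1)).
  by apply: eq_integrable => // t _ /=; rewrite /w EFinB !EFinM.
have w_ge0 e : `|e| = 1 -> {ae mu, forall t, 0 < t -> 0 <= w e t}.
  move=> e1; apply: horner_expR_ge0_ae (iw e) _ => p p0.
  pose Fp t := p.[expR (- t)] * F t.
  pose Mp t := p.[expR (- t)] * (expR (- t) * M t).
  have iFp : mu.-integrable pos (EFin \o Fp).
    by apply: integrable_horner_expR; exact: fi.
  have iMp : mu.-integrable pos (EFin \o Mp) by exact: integrable_horner_expR.
  have -> : \int[mu]_(t in pos) (p.[expR (- t)] * w e t) =
      \int[mu]_(t in pos) (K * Mp t - e * Fp t).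
    by apply: eq_Rintegral => t _; rewrite /w /Mp /Fp; ring.
  rewrite RintegralB//; last 2 first.
  - exact: (integrableZl measurable_pos K iMp).
  - exact: (integrableZl measurable_pos e iFp).
  rewrite !RintegralZl// subr_ge0.
  have FpE : \int[mu]_(t in pos) Fp t =
      kappa * \sum_(i < size p) p`_i * (g (1 + sg + i%:R) * lap h (1 + sg + i%:R)).
    have [_ E] := lap_sum (size p) (fun i => p`_i) fi sg1.
    transitivity (\sum_(i < size p) p`_i * lap f (1 + sg + i%:R)).
      rewrite E; apply: eq_Rintegral => t _; rewrite /Fp /F mulrA; congr (_ * _).
      rewrite horner_coef mulr_suml; apply: eq_bigr => i _.
      rewrite -expRM_natl -mulrA -expRD; congr (_ * expR _); ring.
    rewrite mulr_sumr; apply: eq_bigr => i _; rewrite fE; last by rewrite ltr_wpDr.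
    by rewrite mulrCA.
  apply: le_trans (ler_norm _) _.
  rewrite normrM e1 mul1r FpE normrM /K -mulrA ler_wpM2l//.
  exact: lap_test_le hM sg0 _ p0 _ Pg.
have := w_ge0 1 (normr1 _); have := w_ge0 (- 1) (normrN1 _).
apply: filterS2; first exact: (ae_filter_ringOfSetsType mu).
move=> t wN wP t0; have {}wN := wN t0; have {}wP := wP t0.
(* Dividing by the weight of [f] leaves the growth factor [exp (sg t)]. *)
have E : expR (- ((1 + sg) * t)) * expR (sg * t) = expR (- t).
  by rewrite -expRD; congr expR; ring.
have e0 := expR_gt0 (- ((1 + sg) * t)).
move: wN wP; rewrite /w /F -E -/K.
set e := expR (- _) in e0 *; move=> wN wP.
have -> : K * (expR (sg * t) * M t) = (e * (K * (expR (sg * t) * M t))) / e.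
  by field; rewrite gt_eqF.
rewrite ler_pdivlMr//.
have -> : `|f t| * e = `|e * f t| by rewrite normrM (gtr0_norm e0) mulrC.
rewrite ler_norml.
by apply/andP; split; lra.
Qed.

(** Off [D] the patched function is 0, which [0 <= y] covers. *)
Lemma Linfty_normP (D : set R) (f : R -> R) (y : \bar R) : (0 <= y)%E ->
  (Linfty_norm D f <= y)%E <->
  {ae mu, forall t, D t -> (`|f t|%:E <= y)%E}.
Proof.
move=> y0; rewrite /Linfty_norm unlock /Lnorm.
have -> : (0 < mu [set: R])%E.
  by rewrite -set_itvNyy lebesgue_measure_itv/= addye// ltry.
split=> [/ess_supP|] H.
  apply: filterS H => t /=; rewrite patchE => + Dt.
  by rewrite mem_set.
apply/ess_supP; apply: filterS H; first exact: (ae_filter_ringOfSetsType mu).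
move=> t Ht /=; rewrite patchE; case: ifPn => [/set_mem/Ht//|_].
by rewrite normr0.
Qed.

Lemma laplace_real (f : R -> R) (l : R) :
  complex.Re (laplace f (l%:C)%C) = lap f l.
Proof.
rewrite /laplace /lap /=; apply: eq_Rintegral => t _.
by rewrite mul0r cos0 mulr1.
Qed.

Section Iteration.
Variables (a b : R) (h : nat -> R -> R) (u1 u2 : nat -> R -> R[i] -> R[i]).
Hypothesis ha : 0 < a.
Hypothesis hab : a < b.
Hypothesis hdnwr : dnwr_iteration a b (1 / 2) h u1 u2.

Lemma lap_iterate n l : 0 < l ->
  lap (h n) l = (- (1 / 2)) ^+ n * (dnwr_factor a b l ^+ n * lap (h 0%N) l).
Proof.
move=> l0; elim: n => [|n IH]; first by rewrite !expr0 !mul1r.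
have := sweep_factor ha hab l0 (dnwr_step hdnwr n (s := (l%:C)%C) l0).
by rewrite !laplace_real IH => ->; rewrite !exprS; ring.
Qed.

(** Comparison with the n-th power of the factor and [kappa = (- 1 / 2) ^ n]. For [0 < n] the
    transform of [h n] exists by [dnwr_transformable]. *)
Lemma iterate_ae_le n (M : R -> R) C sg : measurable_fun setT M ->
  (forall t, 0 <= M t) -> (forall t, M t <= C) -> {homo M : s t / s <= t} ->
  {ae mu, forall t, 0 < t -> `|h 0%N t| <= M t} -> 0 < sg -> (0 < n)%N ->
  {ae mu, forall t, 0 < t ->
    `|h n t| <= (dnwr_factor a b sg / 2) ^+ n * expR (sg * t) * M t}.
Proof.
move=> mM M0 MC Mh hM sg0 n0.
have := laplace_comparison (dnwr_initial_measurable hdnwr) mM M0 MC Mh hM sg0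
  (exp_sum_limitX n (exp_sum_limit_dnwr_factor ha hab)) _ (lap_iterate n).
have fi : lap_integrable (h n).
  by case: n n0 => // n _; have [_] := dnwr_transformable hdnwr n.
move=> /(_ fi); apply: filterS; first exact: (ae_filter_ringOfSetsType mu).
move=> t Ht t0; rewrite (le_trans (Ht t0))// mulrA.
rewrite normrX normrN ger0_norm// -exprMn.
by rewrite (_ : 1 / 2 * _ = dnwr_factor a b sg / 2); last by ring.
Qed.

End Iteration.
End DNWR.

(* Chernoff's bound: [s] minimises [s ^+ 2 * T - 4 * a * k%:R * s], the exponent
   of [expR (s ^+ 2 * T) * expR (- (2 * a * s)) ^+ (2 * k)]. *)
Lemma dnwr_factor_superlinear {R : realType} (a b T t : R) (k : nat)
    (s := 2 * a * k%:R / T) :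
  0 < a -> a < b -> 0 < T -> t <= T -> (0 < k)%N ->
  (dnwr_factor a b (s ^+ 2) / 2) ^+ (2 * k) * expR (s ^+ 2 * t) <=
  (Num.sqrt 2 / (1 - expR (- ((2 * k + 1)%:R * a ^+ 2 / T)))) ^+ (2 * k)
    * expR (- (k%:R ^+ 2 * a ^+ 2 / T)).
Proof.
move=> a0 ab T0 tT k0.
have kR0 : (0 : R) < k%:R by rewrite ltr0n.
have s0 : 0 < s by rewrite divr_gt0 ?mulr_gt0.
have sg0 : 0 < s ^+ 2 by rewrite exprn_gt0.
have := dnwr_factor_le_expR a0 ab sg0; have := dnwr_factor_gt0 a0 ab sg0.
rewrite sqrtr_sqr (gtr0_norm s0).
set E := expR (- (2 * a * s)); set E' := expR (- (_%:R * _ / _)) => G0 G1.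
have E0 : 0 < E by exact: expR_gt0.
have aT0 : 0 < a ^+ 2 / T by rewrite divr_gt0 ?exprn_gt0.
(* [E = exp (- 4 k a ^ 2 / T)], and [2 k + 1 <= 4 k] since [k] is positive. *)
have EE' : E <= E'.
  rewrite ler_expR lerN2 -mulrA.
  have -> : 2 * a * s = (4 * k)%:R * (a ^+ 2 / T).
    by rewrite /s natrM; field; rewrite gt_eqF.
  by rewrite ler_wpM2r ?(ltW aT0)// ler_nat; lia.
have E'1 : E' < 1.
  by rewrite expR_lt1 oppr_lt0 -mulrA mulr_gt0// ltr0n addn1.
have E1 : E < 1 by exact: le_lt_trans E'1.
have step1 : (dnwr_factor a b (s ^+ 2) / 2) ^+ (2 * k) <=
    (1 - E)^-1 ^+ (2 * k) * E ^+ (2 * k).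
  rewrite -exprMn; apply: lerXn2r; rewrite ?nnegrE.
  - by rewrite divr_ge0// ltW.
  - by rewrite mulr_ge0 ?(ltW E0)// invr_ge0 subr_ge0 ltW.
  rewrite ler_pdivrMr// (le_trans G1)// le_eqVlt; apply/orP; left; apply/eqP.
  by ring.
(* The factor [sqrt 2] enters only through [1 <= sqrt 2]. *)
have step2 : (1 - E)^-1 ^+ (2 * k) <= (Num.sqrt 2 / (1 - E')) ^+ (2 * k).
  have iE : 0 < (1 - E)^-1 by rewrite invr_gt0 subr_gt0.
  have iE' : 0 < (1 - E')^-1 by rewrite invr_gt0 subr_gt0.
  apply: lerXn2r; rewrite ?nnegrE ?(ltW iE)//.
    by rewrite mulr_ge0 ?sqrtr_ge0 ?(ltW iE').
  have : (1 - E)^-1 <= (1 - E')^-1 by rewrite lef_pV2 ?posrE ?subr_gt0// lerD2l lerN2.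
  move=> /le_trans; apply; rewrite ler_peMl ?(ltW iE')//.
  by rewrite -[leLHS]sqrtr1 ler_wsqrtr// ler1n.
(* At [t = T] the exponent is [- 8 + 4 = - 4] times [k ^ 2 a ^ 2 / T], which is then weakened to
   [- 1] times it. *)
have step3 : E ^+ (2 * k) * expR (s ^+ 2 * t) <= expR (- (k%:R ^+ 2 * a ^+ 2 / T)).
  rewrite -expRM_natl -expRD ler_expR.
  have st : s ^+ 2 * t <= s ^+ 2 * T by rewrite ler_pM2l.
  apply: (@le_trans _ _ ((2 * k)%:R * - (2 * a * s) + s ^+ 2 * T)).
    by rewrite lerD2l.
  have -> : (2 * k)%:R * - (2 * a * s) + s ^+ 2 * T =
    - (4 * (k%:R ^+ 2 * a ^+ 2 / T)).
    by rewrite /s natrM; field; rewrite gt_eqF.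
  have : 0 <= k%:R ^+ 2 * a ^+ 2 / T.
    by apply: divr_ge0; [apply: mulr_ge0; exact: sqr_ge0|exact: ltW].
  by rewrite lerN2; lra.
apply: (@le_trans _ _ ((1 - E)^-1 ^+ (2 * k) * E ^+ (2 * k) * expR (s ^+ 2 * t))).
  by rewrite ler_wpM2r ?expR_ge0.
rewrite -mulrA; apply: ler_pM => //.
- by rewrite exprn_ge0// invr_ge0 subr_ge0 ltW.
- by rewrite mulr_ge0 ?expR_ge0// exprn_ge0// ltW.
Qed.

(** * The linear and superlinear estimates *)

Theorem theorem2p3 (R : realType) (a b : R) (h : nat -> R -> R)
    (u1 u2 : nat -> R -> R[i] -> R[i])
    (ha : 0 < a) (hab : a < b)
    (hdnwr : dnwr_iteration a b (1 / 2) h u1 u2) :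
  (forall k : nat, (1 <= k)%N ->
     (Linfty_norm `]0%R, +oo[%classic (h (2 * k)%N) <=
      (((b - a) / (2 * a)) ^+ (2 * k))%:E * Linfty_norm `]0%R, +oo[%classic (h 0%N))%E)
  /\
  (forall T : R, 0 < T -> forall k : nat, (1 <= k)%N ->
     (Linfty_norm `]0%R, T[%classic (h (2 * k)%N) <=
      ((Num.sqrt 2 / (1 - expR (- ((2 * k + 1)%:R * a ^+ 2 / T)))) ^+ (2 * k)
        * expR (- (k%:R ^+ 2 * a ^+ 2 / T)))%:E
      * Linfty_norm `]0%R, T[%classic (h 0%N))%E).
Proof.
pose mu := @lebesgue_measure R.
have norm_ge0 (D : set R) (f : R -> R) : (0 <= Linfty_norm D f)%E.
  exact: Lnorm_ge0.
have N_lty := dnwr_initial_bounded hdnwr.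
set Noo := Linfty_norm _ _ in N_lty *.
have [N NE] : exists N : R, Noo = N%:E.
  by exists (fine Noo); rewrite fineK// ge0_fin_numE// norm_ge0.
have N0 : 0 <= N by rewrite -lee_fin -NE norm_ge0.
have hN : {ae mu, forall t, 0 < t -> `|h 0%N t| <= N}.
  have [+ _] := Linfty_normP `]0, +oo[%classic (h 0%N) (norm_ge0 `]0, +oo[%classic (h 0%N)).
  move=> /(_ (lexx _)); apply: filterS; first exact: (ae_filter_ringOfSetsType mu).
  by move=> t Ht t0; rewrite -lee_fin -NE Ht//= in_itv/= t0.
have ba0 : 0 <= (b - a) / (2 * a) by rewrite divr_ge0 ?subr_ge0 ?mulr_ge0 ?ltW.
split=> [k k1|T T0 k k1].
  have n0 : (0 < 2 * k)%N by rewrite muln_gt0.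
  rewrite NE -EFinM; apply/Linfty_normP.
    by rewrite lee_fin mulr_ge0// exprn_ge0.
  (* A square, so that [sqrt (sg i)] is [1 / (i + 1)]; a sequence, so that the exceptional null sets
     are countably many. *)
  pose sg (i : nat) : R := i.+1%:R^-1 ^+ 2.
  have sg0 i : 0 < sg i by rewrite exprn_gt0// invr_gt0 ltr0n.
  have bound i := iterate_ae_le ha hab hdnwr (@measurable_cst _ _ _ _ setT N)
    (fun=> N0) (fun=> lexx N) (fun _ _ _ => lexx N) hN (sg0 i) n0.
  have := ae_foralln bound.
  apply: filterS => t Ht; rewrite /= in_itv/= andbT => t0; rewrite lee_fin.
  pose B (i : nat) : R := ((b - a) / (2 * a) * expR (b * i.+1%:R^-1)) ^+ (2 * k) *
    expR (sg i * t) * N.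
  have B_cvg : B i @[i --> \oo] --> ((b - a) / (2 * a)) ^+ (2 * k) * N.
    have invn : (i.+1%:R^-1 : R) @[i --> \oo] --> (0 : R) by exact: cvg_harmonic.
    have expB : expR (b * i.+1%:R^-1) @[i --> \oo] --> (1 : R).
      suff : expR (b * i.+1%:R^-1) @[i --> \oo] --> expR (b * 0).
        by rewrite mulr0 expR0.
      apply: continuous_cvg; first exact: continuous_expR.
      by apply: cvgM => //; exact: cvg_cst.
    have expS : expR (sg i * t) @[i --> \oo] --> (1 : R).
      suff : expR (sg i * t) @[i --> \oo] --> expR (0 * 0 * t).
        by rewrite !mul0r expR0.
      apply: continuous_cvg; first exact: continuous_expR.
      by apply: cvgM; [rewrite /sg; under eq_fun do rewrite expr2; exact: cvgM|exact: cvg_cst].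
    suff : B i @[i --> \oo] --> ((b - a) / (2 * a) * 1) ^+ (2 * k) * 1 * N.
      by rewrite !mulr1.
    apply: cvgM; last exact: cvg_cst.
    apply: cvgM => //.
    apply: (@continuous_cvg _ _ _ _ _ _ (fun x : R => x ^+ (2 * k))).
      exact: exprn_continuous.
    by apply: cvgM => //; exact: cvg_cst.
  apply: cvgr_to_ge B_cvg _; apply: nearW => i.
  apply: le_trans (Ht i t0) _.
  have G0 := dnwr_factor_gt0 ha hab (sg0 i).
  rewrite /B ler_wpM2r// ler_wpM2r ?expR_ge0//.
  apply: lerXn2r; rewrite ?nnegrE; first by rewrite divr_ge0// ltW.
    by rewrite mulr_ge0 ?expR_ge0.
  have := dnwr_factor_le ha hab (sg0 i).
  rewrite /sg sqrtr_sqr ger0_norm ?invr_ge0// => G1.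
  rewrite ler_pdivrMr// (le_trans G1)// le_eqVlt; apply/orP; left; apply/eqP.
  by field; rewrite gt_eqF.
have n0 : (0 < 2 * k)%N by rewrite muln_gt0.
set NT := Linfty_norm _ (h 0%N).
(* This makes [NT] finite and the step function [M] below nondecreasing. *)
have NT_le : (NT <= Noo)%E.
  apply/Linfty_normP; first by rewrite NE lee_fin.
  apply: filterS hN; first exact: (ae_filter_ringOfSetsType mu).
  by move=> t Ht; rewrite /= in_itv/= => /andP[t0 _]; rewrite NE lee_fin Ht.
have [Mt ME] : exists Mt : R, NT = Mt%:E.
  exists (fine NT); rewrite fineK// ge0_fin_numE ?norm_ge0//.
  exact: le_lt_trans N_lty.
have Mt0 : 0 <= Mt by rewrite -lee_fin -ME norm_ge0.
have MtN : Mt <= N by rewrite -lee_fin -ME -NE.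
have hT : {ae mu, forall t, 0 < t -> t < T -> `|h 0%N t| <= Mt}.
  have [+ _] := Linfty_normP `]0, T[%classic (h 0%N) (norm_ge0 `]0, T[%classic (h 0%N)).
  move=> /(_ (lexx _)); apply: filterS; first exact: (ae_filter_ringOfSetsType mu).
  by move=> t Ht t0 tT; rewrite -lee_fin -ME Ht//= in_itv/= t0.
(* [N] dominates [h 0] after time [T], but only the value [Mt] enters the bound for [t < T]. *)
pose M t := if t < T then Mt else N.
have mM : measurable_fun setT M.
  apply: measurable_fun_ifT => //.
  exact: measurable_fun_ltr.
have M0 t : 0 <= M t by rewrite /M; case: ifP.
have MN t : M t <= N by rewrite /M; case: ifP.
have Mh : {homo M : s t / s <= t}.
  move=> s t st; rewrite /M; case: ltP => sT; case: ltP => tT //.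
  by move: tT; rewrite ltNge (le_trans sT st).
have hM : {ae mu, forall t, 0 < t -> `|h 0%N t| <= M t}.
  apply: filterS2 hN hT; first exact: (ae_filter_ringOfSetsType mu).
  by move=> t h1 h2 t0; rewrite /M; case: ltP => tT; [exact: h2|exact: h1].
pose s := 2 * a * k%:R / T.
have k0 : (0 : R) < k%:R by rewrite ltr0n.
have s0 : 0 < s by rewrite divr_gt0 ?mulr_gt0.
have sg0 : 0 < s ^+ 2 by rewrite exprn_gt0.
have := iterate_ae_le ha hab hdnwr mM M0 MN Mh hM sg0 n0.
rewrite ME -EFinM => H; apply/Linfty_normP.
  rewrite lee_fin mulr_ge0// mulr_ge0 ?expR_ge0// exprn_ge0//.
  rewrite divr_ge0 ?sqrtr_ge0// subr_ge0 expR_le1 oppr_le0.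
  by apply: divr_ge0; [apply: mulr_ge0 => //; exact: sqr_ge0|exact: ltW].
apply: filterS H; first exact: (ae_filter_ringOfSetsType mu).
move=> t Ht; rewrite /= in_itv/= => /andP[t0 tT]; rewrite lee_fin.
apply: le_trans (Ht t0) _; rewrite /M tT ler_wpM2r//.
exact: dnwr_factor_superlinear (ltW tT) k1.
Qed.
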